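(* If $\Gamma$ is a circular polygon, then there is a set $\mathcal{J}\subset\mathcal{M}$ accumulating on $\partial\mathcal{M}$ such that the return map $F:\mathcal{J}\to\mathcal{J}$ of the billiard map $f$ to $\mathcal{J}$ is topologically semiconjugate to a transitive subshift on infinitely many symbols that contains the full $N$-shift as a topological factor for any $N\in\mathbb{N}$; so the return map $F$ has infinite topological entropy.
   Context: **Circular polygons.** A circular $k$-gon is a simple closed strictly convex curve $\Gamma\subset\mathbb{R}^2\simeq\mathbb{C}$ formed by the concatenation of $k>1$ circular arcs $\Gamma_1,\dots,\Gamma_k$ (listed counter-clockwise, index modulo $k$) that is $C^1$ but not $C^2$ at the intersection point (node) of any two consecutive arcs; so consecutive arcs have different radii, and circles are excluded. A circular polygon is a circular $k$-gon for some $k$. The arc $\Gamma_j$ has center $O_j$, radius $r_j>0$ and angular range $[a_j,b_j]$, with $b_j=a_{j+1}$ and $a_1<b_1=a_2<\cdots<b_{k-1}=a_k<b_k=a_1+2\pi$. The polar parametrisation is $z:\mathbb{T}=\mathbb{R}/2\pi\mathbb{Z}\to\Gamma$, $z(\varphi)=O_j+r_je^{i\varphi}$ for $\varphi\in[a_j,b_j]$. **Billiard map.** $\mathcal{M}=\mathbb{T}\times[0,\pi]$, $\partial\mathcal{M}=\mathbb{T}\times\{0,\pi\}$. For $0<\theta<\pi$, the line through $z(\varphi)$ in the direction $v$ obtained by rotating $z'(\varphi)$ counter-clockwise by $\theta$ meets $\Gamma$ at exactly one other point $z(\bar\varphi)$; $\bar\theta\in(0,\pi)$ is the counter-clockwise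 angle from $v$ to $z'(\bar\varphi)$, and $f(\varphi,\theta)=(\bar\varphi,\bar\theta)$. Setting $f=\mathrm{id}$ on $\partial\mathcal{M}$, $f:\mathcal{M}\to\mathcal{M}$ is a homeomorphism. **Terminology.** $\mathcal{J}$ accumulates on $\partial\mathcal{M}$ if it contains points of $\mathcal M\setminus\partial\mathcal M$ arbitrarily close to $\partial\mathcal{M}$. The return map is $F(x)=f^{\tau(x)}(x)$, $\tau(x)=\min\{n\in\mathbb{N}:f^n(x)\in\mathcal{J}\}$. A subshift on infinitely many symbols is a closed shift-invariant subset $\mathfrak{Q}$ of $\boldsymbol{Q}^{\mathbb{Z}}$ ($\boldsymbol{Q}$ an infinite discrete alphabet, product topology) with the left shift $\sigma$; it is transitive if for all nonempty open $U,V\subset\mathfrak{Q}$ there is $n\in\mathbb{N}$ with $\sigma^n(U)\cap V\neq\emptyset$. $F$ is topologically semiconjugate to $\sigma$ if there is a continuous surjection $h:\mathcal{J}\to\mathfrak{Q}$ with $h\circ F=\sigma\circ h$. The full $N$-shift is the left shift on $\{1,\dots,N\}^{\mathbb{Z}}$; $\sigma$ contains it as a topological factor if some $\sigma$-invariant subset $\mathfrak{Q}_N\subset\mathfrak{Q}$ admits a continuous surjection onto $\{1,\dots,N\}^{\mathbb{Z}}$ intertwining $\sigma|_{\mathfrak{Q}_N}$ and the full $N$-shift. Topological entropy on the possibly non-compact space $\mathcal{J}$ is in the sense of Bowen (with the Euclidean metric). *)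

(* Defs.v *)
From HB Require Import structures.
From mathcomp Require Import all_boot all_order all_algebra.
From mathcomp Require Import generic_quotient finmap.
From mathcomp Require Import all_classical all_reals all_analysis.

Set Implicit Arguments.
Unset Strict Implicit.
Unset Printing Implicit Defensive.

Import Order.TTheory GRing.Theory Num.Theory.
Import numFieldNormedType.Exports.

Local Open Scope quotient_scope.
Local Open Scope classical_set_scope.
Local Open Scope ring_scope.

Section Circle.
Variable R : realType.

Definition angle_eq (x y : R) : bool :=
  `[< exists m : int, x - y = m%:~R * (2 * pi) >].

Lemma angle_eq_refl : reflexive angle_eq.
Proof. by move=> x; apply/asboolP; exists 0; rewrite subrr mul0r. Qed.

Lemma angle_eq_sym : symmetric angle_eq.
Proof.
suff H x y : angle_eq x y -> angle_eq y x by move=> x y; apply/idP/idP; exact: H.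
move=> /asboolP [m xy]; apply/asboolP; exists (- m).
by rewrite -opprB xy rmorphN /= mulNr.
Qed.

Lemma angle_eq_trans : transitive angle_eq.
Proof.
move=> y x z /asboolP [m xy] /asboolP [n yz]; apply/asboolP; exists (m + n).
by rewrite rmorphD /= mulrDl -xy -yz addrA subrK.
Qed.

Canonical angle_equiv :=
  EquivRel angle_eq angle_eq_refl angle_eq_sym angle_eq_trans.

Definition circle : Type := quotient_topology {eq_quot angle_equiv}.

Definition circle_dist (s t : circle) : R :=
  inf [set `|repr s - repr t + m%:~R * (2 * pi)| | m in [set: int]].

End Circle.

Section Plane.
Variable R : realType.

Definition plane : normedModType R := (R^o * R^o)%type.

Definition rotate (theta : R) (v : plane) : plane :=
  (cos theta * v.1 - sin theta * v.2, sin theta * v.1 + cos theta * v.2).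

Definition Cn_on (n : nat) (I : set R) (g : R -> plane) : Prop :=
  (forall m, (m < n)%N -> forall t, I t -> derivable (g^`(m))%classic t 1) /\
  (forall t, I t -> {for t, continuous (g^`(n))%classic}).

(* Near p the set G is an arc with a regular parametrisation of class C^n
   (n >= 1). *)
Definition curve_Cn_at (n : nat) (G : set plane) (p : plane) : Prop :=
  exists (g : R -> plane) (e : R) (U : set plane),
    [/\ 0 < e, open U, U p & g 0 = p] /\
    [/\ g @` `]- e, e[ = G `&` U, set_inj `]- e, e[ g, Cn_on n `]- e, e[ g &
        forall t, `]- e, e[%classic t -> (g^`())%classic t != 0].

Definition strictly_convex_curve (G : set plane) : Prop :=
  exists K : set plane,
    [/\ compact K, G = K `\` K° &
        forall x y, K x -> K y -> x <> y ->
          forall t : R, 0 < t < 1 -> K° (t *: x + (1 - t) *: y)].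

End Plane.

(* k consecutive circular arcs, indexed by 'I_k; ordS is the successor modulo k.
   At the last index the common polar angle of the two arcs is shifted by 2 pi,
   so that b_k = a_1 + 2 pi. *)
Record arc_chain (R : realType) (k : nat) := ArcChain {
  center : 'I_k -> plane R;
  radius : 'I_k -> R;
  ang_start : 'I_k -> R;
  ang_end : 'I_k -> R;
  radius_gt0 : forall j, 0 < radius j;
  ang_lt : forall j, ang_start j < ang_end j;
  ang_next : forall j,
    ang_end j = ang_start (ordS j) + (2 * pi) *+ (j.+1 == k) }.

Section CircularPolygon.
Variables (R : realType) (k : nat) (P : arc_chain R k).

Definition on_circle (j : 'I_k) (phi : R) : plane R :=
  ((center P j).1 + radius P j * cos phi, (center P j).2 + radius P j * sin phi).

Definition arc (j : 'I_k) : set (plane R) :=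
  on_circle j @` `[ang_start P j, ang_end P j].

Definition curve : set (plane R) := \bigcup_(j in [set: 'I_k]) arc j.

Definition node (j : 'I_k) : plane R := on_circle j (ang_end P j).

Definition concatenated : Prop :=
  forall j, node j = on_circle (ordS j) (ang_start P (ordS j)).

(* The polar parametrisation; the value is unique when P is concatenated. *)
Definition polar (s : circle R) : plane R :=
  xget 0 [set p | exists j phi,
    [/\ ang_start P j <= phi <= ang_end P j, \pi_(circle R) phi = s &
        p = on_circle j phi]].

Definition circular_gon : Prop :=
  [/\ (1 < k)%N, concatenated, injective polar & strictly_convex_curve curve] /\
  (forall j, curve_Cn_at 1 curve (node j) /\ ~ curve_Cn_at 2 curve (node j)).

(* The direction i e^{i phi} of z'(phi): on the j-th arc
   z'(phi) = r_j i e^{i phi}, and at a node both one-sided derivatives are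
   positive multiples of it. *)
Definition tangent (s : circle R) : plane R := (- sin (repr s), cos (repr s)).

Definition phase_space : set (circle R * R) := [set x | 0 <= x.2 <= pi].

Definition phase_boundary : set (circle R * R) :=
  [set x | x.2 = 0 \/ x.2 = pi].

Definition bounce (x y : circle R * R) : Prop :=
  let v := rotate x.2 (tangent x.1) in
  [/\ 0 < y.2 < pi, polar y.1 <> polar x.1,
      exists t : R, polar y.1 = polar x.1 + t *: v &
      tangent y.1 = rotate y.2 v].

(* Only the values on phase_space are meaningful. *)
Definition billiard (x : circle R * R) : circle R * R :=
  if 0 < x.2 < pi then xget x [set y | bounce x y] else x.

End CircularPolygon.

Definition phase_dist (R : realType) (x y : circle R * R) : R :=
  Num.sqrt (circle_dist x.1 y.1 ^+ 2 + (x.2 - y.2) ^+ 2).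

Definition clusters_at_boundary (R : realType) (J : set (circle R * R)) :=
  forall e : R, 0 < e -> exists x y,
    [/\ J x, ~ phase_boundary x, phase_boundary y & phase_dist x y < e].

Section FirstReturn.
Variables (X : Type) (f : X -> X) (J : set X).

Definition recurrent : Prop :=
  forall x, J x -> exists2 n, (0 < n)%N & J (iter n f x).

Definition return_time (x : X) : nat :=
  xget 0%N [set n | [/\ (0 < n)%N, J (iter n f x) &
    forall m, (0 < m)%N -> J (iter m f x) -> (n <= m)%N]].

Definition return_map (x : X) : X := iter (return_time x) f x.

End FirstReturn.

Definition semiconjugate (X Y : topologicalType) (A : set X) (F : X -> X)
    (B : set Y) (G : Y -> Y) : Prop :=
  exists h : X -> Y,
    [/\ {within A, continuous h}, h @` A = B &
        forall x, A x -> h (F x) = G (h x)].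

Section Subshift.
Variable Q : discreteTopologicalType.

Definition left_shift (q : {ptws int -> Q}) : {ptws int -> Q} :=
  fun i => q (i + 1).

Definition shift_invariant (S : set {ptws int -> Q}) : Prop :=
  left_shift @` S = S.

Definition subshift (S : set {ptws int -> Q}) : Prop :=
  closed S /\ shift_invariant S.

Definition shift_transitive (S : set {ptws int -> Q}) : Prop :=
  forall U V : set {ptws int -> Q}, open U -> open V ->
    (S `&` U) !=set0 -> (S `&` V) !=set0 ->
    exists2 n, (0 < n)%N &
      (iter n left_shift @` (S `&` U) `&` (S `&` V)) !=set0.

End Subshift.

Definition has_full_shift_factor (Q : discreteTopologicalType)
    (S : set {ptws int -> Q}) (N : nat) : Prop :=
  exists SN : set {ptws int -> Q},
    [/\ SN `<=` S, shift_invariant SN &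
        semiconjugate SN (@left_shift Q)
          [set: {ptws int -> discrete_topology 'I_N}]
          (@left_shift (discrete_topology 'I_N))].

(* Bowen's entropy sup_K lim_(e -> 0) limsup_n (1/n) log s_n(e, K) of a self-map
   F of J, where K ranges over the compact subsets of J. *)
Section BowenEntropy.
Variables (R : realType) (X : topologicalType) (d : X -> X -> R).
Variables (F : X -> X).
Local Open Scope ereal_scope.

Definition separated_set (n : nat) (e : R) (E : set X) : Prop :=
  forall x y, E x -> E y -> x <> y ->
    exists2 i, (i < n)%N & (e < d (iter i F x) (iter i F y))%R.

Definition max_separated (n : nat) (e : R) (K : set X) : \bar R :=
  ereal_sup [set (#|` fset_set E|%fset%:R)%:E | E in
    [set E | [/\ finite_set E, E `<=` K & separated_set n e E]]].

Definition bowen_entropy_on (K : set X) : \bar R :=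
  lim (limn_esup (fun n => (n%:R^-1)%:E * lne (max_separated n e K)) @[e --> 0^'+]).

Definition bowen_entropy (J : set X) : \bar R :=
  ereal_sup [set bowen_entropy_on K | K in
    [set K | compact K /\ K `<=` J]].

End BowenEntropy.

(* Main.v *)
Require Import Defs.
From mathcomp Require Import all_boot all_order all_algebra.
From mathcomp Require Import generic_quotient ring lra zify.
From mathcomp Require Import all_classical all_reals all_analysis.
Set Implicit Arguments.
Unset Strict Implicit.
Unset Printing Implicit Defensive.
Import Order.TTheory GRing.Theory Num.Theory.
Import numFieldNormedType.Exports.
Local Open Scope classical_set_scope.
Local Open Scope ring_scope.
Local Open Scope quotient_scope.

(** Close to the boundary the billiard slides along the curve. On an arc the
    angle of incidence th is constant and the impact point advances by 2 th; at
    a node between the radii r and r', a chord that makes the angle c with the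
    tangent at the node changes th into th', where
      r' (cos c - cos th') = r (cos c - cos th).
    Over a window 0 <= c <= rho th the ratio th' / th sweeps an interval. Since
    about l / (2 th) bounces take place on the next arc, of length l, this
    interval is stretched over many windows at the next node. Hence, by the
    intermediate value theorem, an orbit that starts at a node can realise any
    numbers of bounces on the successive arcs that keep the angles of incidence
    near a given slowly varying sequence d_n, with the freedom of one optional
    extra bounce on each arc. The ratios of consecutive radii differ from 1 and
    have product 1 around the curve, so d_n can be chosen to decrease by a fixed
    factor at each turn.

    The set J consists of the points of such orbits at the turns
    0 = e_0 < e_1 < e_2 < ... in which the extra bounce is made on the first
    arc. The code e is arbitrary, the orbits of different codes are disjoint,
    and the return map moves the visit of turn e_i to that of turn e_(i+1).
    The angle of a point of J determines the turn, and finitely many prefixes of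
    e are possible there, which define disjoint compact sets; so e is locally
    constant on J, and the 2-adic valuations of e_1, e_2, ... give a
    semiconjugacy to the full shift on infinitely many symbols. In the turn j
    the orbit is observed at the fraction 1 / (v + 2) of the first arc, where v
    is the valuation of j; therefore codes with M valuations yield M ^ n orbits
    of length n + 1 that are separated at a scale depending on M only. *)

(** * Crossing a node *)

Section Trig.
Variable R : realType.
Implicit Types x t c th M : R.

Lemma sin_le_id x : 0 <= x -> sin x <= x.
Proof.
move=> x0.
have [c _] : exists2 c, c \in `[0, x] & sin x - sin 0 = cos c * (x - 0).
  apply: MVT_segment => //; apply: continuous_subspaceT.
  exact: continuous_sin.
rewrite sin0 !subr0 => ->.
by rewrite -[leRHS]mul1r ler_wpM2r// cos_le1.
Qed.

Lemma atan_le_id x : 0 <= x -> atan x <= x.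
Proof.
move=> x0.
have [c _] : exists2 c, c \in `[0, x] & atan x - atan 0 = (1 + c ^+ 2)^-1 * (x - 0).
  apply: MVT_segment => //; apply: continuous_subspaceT.
  exact: continuous_atan.
rewrite atan0 !subr0 => ->.
rewrite -[leRHS]mul1r ler_wpM2r// invf_le1 ?ltr_pwDl ?sqr_ge0//.
by rewrite lerDl sqr_ge0.
Qed.

(* The angle whose versine is Q when 0 <= Q <= 1; unlike [acos] it is
   continuous in Q on the whole line. *)
Definition avers (Q : R) : R :=
  2 * atan (Num.sqrt (Q / Num.max 1 (2 - Q))).

(** [cos (2 * atan t) = (1 - t ^ 2) / (1 + t ^ 2)] with [t ^ 2 = Q / (2 - Q)]: for [Q <= 1] the
    maximum in [avers] is [2 - Q]. *)
Lemma cos_avers Q : 0 <= Q <= 1 -> cos (avers Q) = 1 - Q.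
Proof.
move=> /andP[Q0 Q1]; rewrite /avers mulr_natl cos_mulr2n cos_atan.
rewrite max_r; last lra.
rewrite exprVn !sqr_sqrtr ?addr_ge0// ?divr_ge0//; try lra.
by rewrite -mulr_natl; field; apply/andP; split; lra.
Qed.

Lemma avers_ge0 Q : 0 <= avers Q.
Proof. by rewrite mulr_ge0// -atan0 le_atan// sqrtr_ge0. Qed.

Lemma avers_lt_pi Q : avers Q < pi.
Proof. by rewrite /avers; have := atan_ltpi2 (Num.sqrt (Q / Num.max 1 (2 - Q))); lra. Qed.

(** From [atan t <= t] the left side is at most [4 * Q / (2 - Q)]. *)
Lemma avers_sqr_le Q : 0 <= Q <= 1/2 -> avers Q ^+ 2 <= 2 * Q + 2 * Q ^+ 2.
Proof.
move=> /andP[Q0 Q1].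
have le1 : avers Q ^+ 2 <= (2 * Num.sqrt (Q / (2 - Q))) ^+ 2.
  rewrite ler_pXn2r ?nnegrE ?avers_ge0 ?mulr_ge0 ?sqrtr_ge0//.
  rewrite /avers max_r; last lra.
  by rewrite ler_pM2l// atan_le_id ?sqrtr_ge0.
apply: (le_trans le1); rewrite exprMn sqr_sqrtr; last by rewrite divr_ge0//; lra.
rewrite mulrA ler_pdivrMr; nra.
Qed.

Lemma continuous_fcomp (f g : R -> R) :
  continuous f -> continuous g -> continuous (fun u => f (g u)).
Proof. by move=> cf cg u; apply: continuous_comp; [exact: cg|exact: cf]. Qed.

Lemma continuous_avers : continuous avers.
Proof.
apply: (@continuous_fcomp ( *%R 2)); first exact: mulrl_continuous.
apply: (continuous_fcomp (@continuous_atan R)).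
apply: (continuous_fcomp (@sqrt_continuous R)) => Q.
apply: cvgM; first exact: cvg_id.
apply: cvgV; first by rewrite gt_eqF// lt_max ltr01.
have cm : {for Q, continuous ((cst 1 : R -> R^o) \max (fun Q => 2 - Q))}.
  apply: continuous_max; first exact: cvg_cst.
  by apply: cvgB; [exact: cvg_cst|exact: cvg_id].
exact: cm.
Qed.

Lemma cos_lt x y : 0 <= x -> x < y -> y <= pi -> cos y < cos x.
Proof.
move=> x0 xy ypi; rewrite ltr_cos// in_itv/=; apply/andP; split=> //.
  exact: le_trans (ltW xy) ypi.
exact: le_trans x0 (ltW xy).
Qed.

Lemma versE x : 1 - cos x = 2 * sin (x / 2) ^+ 2.
Proof.
have {1}-> : x = (x / 2) *+ 2 by rewrite -mulr_natr divfK.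
by rewrite cos_mulr2n cos2sin2 -mulr_natl; ring.
Qed.

Lemma vers_le x : 0 <= x -> x <= pi -> 1 - cos x <= x ^+ 2 / 2.
Proof.
move=> x0 xpi; rewrite versE.
have : sin (x / 2) <= x / 2 by apply: sin_le_id; lra.
have : 0 <= sin (x / 2) by apply: sin_ge0_pi; apply/andP; split; lra.
nra.
Qed.

Lemma vers_avers x : 0 <= x -> 1 - cos x <= 1 -> x <= pi -> avers (1 - cos x) = x.
Proof.
move=> x0 x1 xpi; apply: cos_inj.
- by rewrite in_itv/= avers_ge0 ltW// avers_lt_pi.
- by rewrite in_itv/= x0 xpi.
- by rewrite cos_avers ?x1 ?andbT ?subr_ge0 ?cos_le1//; ring.
Qed.

(** With [q = 1 - cos x], [avers_sqr_le] reads [x ^ 2 <= 2 * q + 2 * q ^ 2], and [q <= x ^ 2 / 2]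
    bounds the last term. *)
Lemma vers_ge x : 0 <= x <= 1 -> x ^+ 2 / 2 - x ^+ 4 / 4 <= 1 - cos x.
Proof.
move=> /andP[x0 x1]; have pi2 := pi_ge2 R.
have le := vers_le x0 ltac:(lra).
have ge : 0 <= 1 - cos x by rewrite subr_ge0 cos_le1.
have x2 : x ^+ 2 <= 1 by nra.
have := @avers_sqr_le (1 - cos x).
rewrite vers_avers//; [|lra|lra] => /(_ ltac:(apply/andP; split; lra)).
rewrite (_ : x ^+ 4 = (x ^+ 2) ^+ 2); last by rewrite -exprM.
set q := 1 - cos x in le ge *; set y := x ^+ 2 in le x2 *.
have y0 : 0 <= y by exact: sqr_ge0.
nra.
Qed.

(** The refraction law [r' (cos c - cos th') = r (cos c - cos th)], with [M = r / r'], solved for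
    [1 - cos th']. *)
Definition node_vers M c th : R := M * (1 - cos th) + (1 - M) * (1 - cos c).

(* The angle of incidence after passing a node, see [bounce_node]; c is the
   direction of the chord relative to the tangent at the node and M is the
   radius before the node divided by the radius after it. *)
Definition refract M c th : R := avers (node_vers M c th).

Section Refract.
Variables (M c th : R).
Hypotheses (M0 : 0 < M) (c0 : 0 <= c) (cth : c <= th) (th0 : 0 < th).
Hypothesis thM : (1 + M) * th ^+ 2 <= 1.

Let th1 : th < 1.
Proof.
have : 0 < M * th ^+ 2 by rewrite mulr_gt0// exprn_gt0.
by have := thM; nra.
Qed.
Let pi2 := pi_ge2 R.

Let vers_cth : 1 - cos c <= 1 - cos th.
Proof.
rewrite lerD2l lerN2; move: cth; rewrite le_eqVlt => /orP[/eqP->//|clt].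
by apply/ltW/cos_lt => //; move: th1 pi2; lra.
Qed.

Let vers_th0 : 0 < 1 - cos th.
Proof.
by rewrite subr_gt0 -cos0; apply: cos_lt => //; move: th1 pi2; lra.
Qed.

Let vers_c0 : 0 <= 1 - cos c. Proof. by rewrite subr_ge0 cos_le1. Qed.

Let vers_th1 : 1 - cos th <= th ^+ 2 / 2.
Proof. by apply: vers_le; move: th1 pi2 th0; lra. Qed.

Lemma node_vers_gt : 1 - cos c <= node_vers M c th.
Proof.
have : 0 <= M * ((1 - cos th) - (1 - cos c)) by rewrite mulr_ge0 ?subr_ge0// ltW.
by rewrite /node_vers; move: vers_cth; lra.
Qed.

Lemma node_vers_gt0 : 0 < node_vers M c th.
Proof.
move: vers_c0; rewrite le_eqVlt => /orP[/eqP E|]; last first.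
  by move/lt_le_trans; apply; exact: node_vers_gt.
by rewrite /node_vers -E mulr0 addr0 mulr_gt0.
Qed.

Let node_vers_le_incidence : node_vers M c th <= (1 + M) * (1 - cos th).
Proof.
have : 0 <= M * (1 - cos c) by rewrite mulr_ge0// ltW.
by have := vers_cth; rewrite /node_vers; lra.
Qed.

Lemma node_vers_le : node_vers M c th <= 1 / 2.
Proof.
apply: le_trans node_vers_le_incidence _.
have : (1 + M) * (1 - cos th) <= (1 + M) * (th ^+ 2 / 2) by rewrite ler_wpM2l//;
  move: vers_th1 M0; lra.
move: thM; lra.
Qed.

Lemma cos_refract : cos (refract M c th) = 1 - node_vers M c th.
Proof. by rewrite cos_avers// ltW ?node_vers_gt0//=; have := node_vers_le; lra. Qed.

Lemma refract_gt0 : 0 < refract M c th.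
Proof.
rewrite lt_neqAle avers_ge0 andbT; apply/eqP => /esym E.
by have := node_vers_gt0; have := cos_refract; rewrite E cos0; lra.
Qed.

Lemma le_refract : c <= refract M c th.
Proof.
rewrite leNgt; apply/negP => lt.
have := node_vers_gt; have := cos_refract.
have : cos c < cos (refract M c th).
  by apply: cos_lt (avers_ge0 _) lt _; move: cth th1 pi2; lra.
lra.
Qed.

(** To leading order a versine is half the square of the angle, so the refraction law becomes linear
    in the squares of the angles; [vers_le], [vers_ge] and [avers_sqr_le] control the remainder of
    fourth order. *)
Lemma refract_sqr :
  `|refract M c th ^+ 2 - (M * th ^+ 2 + (1 - M) * c ^+ 2)|
    <= 2 * (1 + M) ^+ 2 * th ^+ 4.
Proof.
have M0' := M0; have Q0 := node_vers_gt0; have Q1 := node_vers_le.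
have up := avers_sqr_le (introT andP (conj (ltW Q0) Q1)).
have lo : 2 * node_vers M c th <= refract M c th ^+ 2.
  have := vers_le (avers_ge0 _) (ltW (avers_lt_pi (node_vers M c th))).
  by rewrite -/(refract M c th) cos_refract; lra.
rewrite -/(refract M c th) in up.
have Qle : node_vers M c th <= (1 + M) * (th ^+ 2 / 2).
  by apply: le_trans node_vers_le_incidence _; rewrite ler_wpM2l//; move: vers_th1 M0; lra.
have [[uth h1] hpi] := (vers_th1, th1, pi2); have [[c0' ct] th0'] := (c0, cth, th0).
have lth := @vers_ge th ltac:(apply/andP; split; lra).
have lc := @vers_ge c ltac:(apply/andP; split; lra).
have uc := @vers_le c c0 ltac:(lra).
have c4 : c ^+ 4 <= th ^+ 4 by rewrite ler_pXn2r ?nnegrE// ltW.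
have Q2 : node_vers M c th ^+ 2 <= (1 + M) ^+ 2 * th ^+ 4 / 4.
  have -> : (1 + M) ^+ 2 * th ^+ 4 / 4 = ((1 + M) * (th ^+ 2 / 2)) ^+ 2 by field.
  by rewrite ler_pXn2r ?nnegrE ?(le_trans (ltW Q0) Qle) ?(ltW Q0).
have t4 : 0 <= th ^+ 4 by rewrite exprn_ge0// ltW.
set E := _ + _ * c ^+ 2.
have : `|2 * node_vers M c th - E| <= (1 + M) ^+ 2 * th ^+ 4.
  set t := th ^+ 4 in t4 lth c4 *.
  pose a := th ^+ 2 / 2 - (1 - cos th); pose b := c ^+ 2 / 2 - (1 - cos c).
  have a0 : 0 <= a by rewrite /a; lra.
  have b0 : 0 <= b by rewrite /b; lra.
  have at4 : a <= t / 4 by rewrite /a; lra.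
  have bt4 : b <= t / 4 by rewrite /b; lra.
  have -> : 2 * node_vers M c th - E = - 2 * M * a + 2 * M * b - 2 * b.
    by rewrite /E /node_vers /a /b; field.
  have Ma : 0 <= M * a by rewrite mulr_ge0// ltW.
  have Mb : 0 <= M * b by rewrite mulr_ge0// ltW.
  have Ma' : M * a <= M * (t / 4) by rewrite ler_wpM2l// ltW.
  have Mb' : M * b <= M * (t / 4) by rewrite ler_wpM2l// ltW.
  have Mt : 0 <= M * t by rewrite mulr_ge0// ltW.
  have M2t : 0 <= M ^+ 2 * t by rewrite mulr_ge0// sqr_ge0.
  by rewrite ler_norml; apply/andP; split; lra.
rewrite !ler_norml => /andP[? ?]; apply/andP; split; lra.
Qed.

End Refract.

Lemma continuous_refract M (f g : R -> R) : continuous f -> continuous g ->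
  continuous (fun u => refract M (f u) (g u)).
Proof.
move=> cf cg; apply: (continuous_fcomp continuous_avers).
have vc (h : R -> R) a : continuous h -> continuous (fun u => a * (1 - cos (h u))).
  move=> ch u; apply: cvgM; first exact: cvg_cst.
  by apply: cvgB; [exact: cvg_cst|exact: (continuous_fcomp (@continuous_cos R) ch)].
by move=> u; apply: cvgD; apply: vc.
Qed.

End Trig.

(** * The prescribed angles of incidence *)

Section Crossing.
Variable R : realType.
Implicit Types (p q u : R) (f h : R -> R).

Definition seg p q : set R := [set u | Num.min p q <= u <= Num.max p q].

Lemma seg_le p q : p <= q -> seg p q = `[p, q]%classic.
Proof. by move=> pq; rewrite /seg min_l// max_r//; apply/seteqP; split=> u /=;
  rewrite in_itv. Qed.

Lemma segC p q : seg p q = seg q p.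
Proof. by rewrite /seg minC maxC. Qed.

Lemma seg_left p q : seg p q p.
Proof. by rewrite /seg /= ge_min le_max lexx. Qed.

Lemma seg_right p q : seg p q q.
Proof. by rewrite segC; exact: seg_left. Qed.

Lemma seg_sub p q p' q' : seg p q p' -> seg p q q' -> seg p' q' `<=` seg p q.
Proof.
rewrite /seg /= => /andP[a b] /andP[c d] u /= /andP[lo hi]; apply/andP; split.
  by apply: le_trans lo; rewrite le_min a.
by apply: (le_trans hi); rewrite ge_max b.
Qed.

(** [q'] is the first point where [h >= 0], and [p'] the last point before [q'] where [f <= 0]; the
    intermediate value theorem shows that they are zeros. *)
Let crossing_le f h p q : continuous f -> continuous h -> p <= q ->
  f p <= 0 -> 0 <= h q -> (forall u, seg p q u -> h u < f u) ->
  exists p' q', [/\ seg p q p', seg p q q', f p' = 0, h q' = 0 &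
    forall u, seg p' q' u -> 0 <= f u /\ h u <= 0].
Proof.
move=> cf ch pq fp hq; rewrite !seg_le// => hf.
have cpt a b (g : R -> R) : continuous g -> compact (`[a, b]%classic `&` [set u |
  0 <= g u]).
  move=> cg; apply: compact_closedI; first exact: segment_compact.
  by apply: (@preimage_closed _ _ g [set x | 0 <= x]) => [? _|];
    [exact: cg|exact: closed_ge].
have cid A : {within A, continuous (@id R)} by apply: continuous_subspaceT => ?;
  exact: cvg_id.
have [|q' + minq] := @compact_EVT_min _ R id (`[p, q]%classic `&` [set u |
  0 <= h u]) _ (cpt _ _ _ ch) (cid _).
  by exists q; rewrite /= in_itv/= pq lexx.
rewrite inE /= in_itv/= => -[/andP[pq' qq'] hq'].
have hp : h p <= 0.
  by apply: le_trans fp; apply/ltW/hf; rewrite /= in_itv/= lexx.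
have hq0 : h q' = 0.
  have [|z] := @IVT R h p q' 0 pq' (continuous_subspaceT ch).
    by rewrite ge_min hp le_max hq' orbT.
  rewrite in_itv/= => /andP[pz zq] hz.
  have : q' <= z by apply: minq; rewrite inE /= in_itv/= pz hz (le_trans zq).
  by move=> qz; have /eqP -> : q' == z; rewrite ?eq_le ?qz.
have fq : 0 < f q' by rewrite -hq0; apply: hf; rewrite /= in_itv/= pq' qq'.
have cNf : continuous (fun u => - f u) by move=> u; apply: cvgN; exact: cf.
have [|p' + maxp] := @compact_EVT_max _ R id (`[p, q']%classic `&` [set u |
  0 <= - f u]) _ (cpt _ _ _ cNf) (cid _).
  by exists p; rewrite /= in_itv/= pq' lexx oppr_ge0.
rewrite inE /= in_itv/= oppr_ge0 => -[/andP[pp' pq''] fp'].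
have fp0 : f p' = 0.
  have [|z] := @IVT R f p' q' 0 pq'' (continuous_subspaceT cf).
    by rewrite ge_min fp' le_max (ltW fq) orbT.
  rewrite in_itv/= => /andP[pz zq] fz.
  have : z <= p' by apply: maxp; rewrite inE /= in_itv/= zq fz oppr0 (le_trans pp').
  by move=> zp; have /eqP -> : p' == z; rewrite ?eq_le ?zp ?pz.
exists p', q'; split=> //; rewrite ?seg_le//= ?in_itv/= ?pp' ?pq' ?qq' ?(le_trans pq'')//.
move=> u; rewrite in_itv/= => /andP[pu uq]; split; rewrite leNgt; apply/negP => lt0.
  have : u <= p' by apply: maxp; rewrite inE /= in_itv/= uq oppr_ge0 (ltW lt0) (le_trans
    pp').
  by move=> up; move: lt0; rewrite (_ : u = p') ?fp0 ?ltxx//; apply/eqP; rewrite eq_le up.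
have : q' <= u by apply: minq; rewrite inE /= in_itv/= (le_trans pp' pu) (le_trans uq)
  ?(ltW lt0).
by move=> qu; move: lt0; rewrite (_ : u = q') ?hq0 ?ltxx//; apply/eqP; rewrite eq_le uq.
Qed.

(** A reflection reduces [q < p] to the other order. Both orders occur, since the two ends may be
    exchanged at each node, see [sweeping_step]. *)
Lemma crossing f h p q : continuous f -> continuous h ->
  f p <= 0 -> 0 <= h q -> (forall u, seg p q u -> h u < f u) ->
  exists p' q', [/\ seg p q p', seg p q q', f p' = 0, h q' = 0 &
    forall u, seg p' q' u -> 0 <= f u /\ h u <= 0].
Proof.
move=> cf ch fp hq hf; have [pq|/ltW qp] := leP p q; first exact: crossing_le.
have segN a b u : seg (- a) (- b) u -> seg a b (- u).
  rewrite /seg /= -oppr_max -oppr_min => /andP[? ?].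
  by apply/andP; split; rewrite 1?lerNr 1?lerNl// opprK.
have cN (g : R -> R) : continuous g -> continuous (fun u : R => g (- u)).
  by move=> cg; apply: continuous_fcomp => // u; exact: opp_continuous.
have [||||p' [q' [sp sq fp' hq' H]]] := @crossing_le (fun u => f (- u)) (fun u => h (-
  u)) (- p) (- q) (cN _ cf) (cN _ ch).
- by rewrite lerN2.
- by rewrite opprK.
- by rewrite opprK.
- by move=> u /segN /hf.
exists (- p'), (- q'); split=> //; [exact: segN|exact: segN|].
by move=> u /segN /H; rewrite opprK.
Qed.

Lemma unif_small (Q : nat -> R -> Prop) k :
  (forall n, exists2 e, 0 < e & forall x, 0 < x <= e -> Q n x) ->
  exists2 e, 0 < e & forall n x, (n < k)%N -> 0 < x <= e -> Q n x.
Proof.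
move=> H; elim: k => [|k [e e0 IH]]; first by exists 1.
have [e' e'0 He] := H k; exists (Num.min e e'); first by rewrite lt_min e0.
move=> n x; rewrite ltnS leq_eqVlt le_min => + /and3P[x0 xe xe'].
by move=> /predU1P[->|/IH]; [apply: He|apply]; apply/andP.
Qed.

Lemma close_gap (a b : R) : 0 < a -> a < b -> exists2 e, 0 < e &
  forall g, 0 < g <= e -> a * (1 + g) ^+ 2 + g <= (1 - g) ^+ 2 * b.
Proof.
move=> a0 ab; have s0 : 0 < 2 * b + 3 * a + 1 by lra.
(* For [g <= 1], replacing [g ^ 2] by [g] on the left and by [0] on the right leaves
   [g * (2 * b + 3 * a + 1) <= b - a]. *)
exists (Num.min 1 ((b - a) / (2 * b + 3 * a + 1))).
  by rewrite lt_min ltr01 divr_gt0// subr_gt0.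
move=> g; rewrite le_min => /and3P[g0 g1]; rewrite ler_pdivlMr// => gs.
have g2 : g ^+ 2 <= g by rewrite expr2 -[leRHS]mulr1 ler_pM2l.
have ag : a * g ^+ 2 <= a * g by rewrite ler_pM2l.
have bg : 0 <= b * g ^+ 2 by rewrite mulr_ge0 ?sqr_ge0//; lra.
lra.
Qed.

End Crossing.

Section Schedule.
Variables (R : realType) (k : nat) (r l : nat -> R).
Hypotheses (k_gt0 : (0 < k)%N) (r_gt0 : forall n, 0 < r n) (l_gt0 : forall n, 0 < l n).
Hypotheses (rP : forall n, r (n + k) = r n) (lP : forall n, l (n + k) = l n).
Hypothesis r_neq : forall n, r n != r n.+1.

Definition ratio n := r n / r n.+1.

(* The angles of incidence are prescribed to be multiplied by [drift n] at the
   n-th node: drift n ^ 2 is the harmonic mean of 1 and [ratio n], which makes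
   the product over one turn smaller than 1. *)
Definition drift n := Num.sqrt (2 * ratio n / (1 + ratio n)).
Definition drift_turn := \prod_(n < k) drift n.

(* A chord with |c| <= width n * theta passes the n-th node in such a way that
   theta ^ 2 is multiplied by a number between ratio n (when c = 0) and
   [ratio_far n] (when c = width n * theta); drift n ^ 2 lies strictly in
   between. *)
Definition width n := (1 + 2 * ratio n) / (2 * (1 + ratio n)).
Definition ratio_far n := ratio n + (1 - ratio n) * width n ^+ 2.

Lemma ratio_gt0 n : 0 < ratio n. Proof. by rewrite divr_gt0. Qed.

Lemma ratioP n : ratio (n + k) = ratio n.
Proof. by rewrite /ratio -addSn !rP. Qed.

Lemma drift_sqr n : drift n ^+ 2 = 2 * ratio n / (1 + ratio n).
Proof. by have M0 := ratio_gt0 n; rewrite sqr_sqrtr// divr_ge0//; lra. Qed.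

Lemma drift_gt0 n : 0 < drift n.
Proof. by have M0 := ratio_gt0 n; rewrite sqrtr_gt0 divr_gt0//; lra. Qed.

Lemma width_itv n : 0 < width n < 1.
Proof.
have M0 := ratio_gt0 n; rewrite divr_gt0//=; [|by lra..].
by rewrite ltr_pdivrMr; lra.
Qed.

Lemma ratio_neq1 n : ratio n != 1.
Proof.
apply: contra (r_neq n) => /eqP E; apply/eqP.
by rewrite -[LHS](divfK (lt0r_neq0 (r_gt0 n.+1))) -/(ratio n) E mul1r.
Qed.

(** With [M = ratio n], the factor [drift n ^ 2] belongs to [(c / theta) ^ 2 = M / (1 + M)]. As
    [width n] is the arithmetic mean of [1] and [M / (1 + M)], it exceeds their geometric mean, so
    this chord lies inside the window. *)
Lemma drift_between n :
  [/\ 0 < Num.min (ratio n) (ratio_far n),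
   Num.min (ratio n) (ratio_far n) < drift n ^+ 2 &
   drift n ^+ 2 < Num.max (ratio n) (ratio_far n)].
Proof.
have := ratio_gt0 n; have := ratio_neq1 n; move ME : (ratio n) => M M1 M0.
have near : drift n ^+ 2 - M = M * (1 - M) / (1 + M).
  by rewrite drift_sqr ME; field; lra.
have far : ratio_far n - drift n ^+ 2 = (1 - M) / (4 * (1 + M) ^+ 2).
  by rewrite /ratio_far /width drift_sqr ME; field; lra.
have s0 : 0 < 4 * (1 + M) ^+ 2 by rewrite mulr_gt0// exprn_gt0; lra.
have [Mlt|Mgt|Meq] := ltgtP M 1; last by rewrite Meq eqxx in M1.
  have d1 : 0 < drift n ^+ 2 - M by rewrite near divr_gt0 ?mulr_gt0//; lra.
  have d2 : 0 < ratio_far n - drift n ^+ 2 by rewrite far divr_gt0//; lra.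
  by rewrite min_l ?max_r; [split|..]; lra.
have d1 : 0 < - (drift n ^+ 2 - M).
  by rewrite near -mulNr -mulrN divr_gt0 ?mulr_gt0//; lra.
have d2 : 0 < - (ratio_far n - drift n ^+ 2).
  by rewrite far -mulNr divr_gt0//; lra.
have [w0 w1] := andP (width_itv n).
have f0 : 0 < ratio_far n.
  have -> : ratio_far n = M * (1 - width n ^+ 2) + width n ^+ 2.
    by rewrite /ratio_far ME; ring.
  have w2 : 0 < 1 - width n ^+ 2 by rewrite subr_gt0 expr_lt1// ltW.
  by apply: addr_gt0; [exact: mulr_gt0|exact: exprn_gt0].
by rewrite min_r ?max_l; [split|..]; lra.
Qed.

Lemma drift_turn_ge0 : 0 <= drift_turn.
Proof. by rewrite prodr_ge0// => n _; rewrite ltW ?drift_gt0. Qed.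

(** The harmonic mean of [1] and [ratio n] is less than the geometric mean, that is,
    [drift n ^ 4 < ratio n]; the ratios telescope to [1] around the polygon. *)
Lemma drift_turn_lt1 : drift_turn < 1.
Proof.
rewrite ltNge; apply/negP => ge1.
have : drift_turn ^+ 4 < \prod_(n < k) ratio n.
  rewrite -prodrXl -(big_mkord xpredT (fun n => drift n ^+ 4)) -(big_mkord xpredT ratio).
  apply: ltr_prod_nat => // n _; have M0 := ratio_gt0 n.
  rewrite (exprM _ 2 2) drift_sqr sqr_ge0/= exprMn exprVn.
  rewrite ltr_pdivrMr ?exprn_gt0 ?addr_gt0// -subr_gt0.
  have -> : ratio n * (1 + ratio n) ^+ 2 - (2 * ratio n) ^+ 2
    = ratio n * (1 - ratio n) ^+ 2 by ring.
  by rewrite mulr_gt0// lt_neqAle sqr_ge0 eq_sym sqrf_eq0 subr_eq0 eq_sym ratio_neq1.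
have -> : \prod_(n < k) ratio n = 1.
  have tele m : \prod_(n < m) ratio n = r 0 / r m.
    elim: m => [|m IH]; first by rewrite big_ord0 divff// gt_eqF.
    rewrite big_ord_recr/= IH /ratio mulrA divfK// gt_eqF//.
  by rewrite tele -[r k]/(r (0 + k)) rP divff// gt_eqF.
by rewrite ltNge exprn_ege1.
Qed.

Definition prescribed (d0 : R) n := d0 * \prod_(m < n) drift m.

Lemma driftP n : drift (n + k) = drift n.
Proof. by rewrite /drift ratioP. Qed.

Lemma prescribedD d0 n : prescribed d0 (n + k) = drift_turn * prescribed d0 n.
Proof.
rewrite /prescribed mulrCA; congr (d0 * _); elim: n => [|n IH].
  by rewrite big_ord0 mulr1.
by rewrite addSn !big_ord_recr /= IH driftP mulrA.
Qed.

Lemma prescribedM d0 j : prescribed d0 (k * j) = drift_turn ^+ j * d0.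
Proof.
elim: j => [|j IH]; first by rewrite muln0 /prescribed big_ord0 mulr1 mul1r.
by rewrite mulnS addnC prescribedD IH exprS mulrA.
Qed.

(* [g] is the relative error with which the prescribed angles are realised. *)
Definition small g n x :=
  [/\ 8 * x <= g * l n, (1 + ratio n) * (2 * x) ^+ 2 <= 1 &
      32 * (1 + ratio n) ^+ 2 * x ^+ 2 <= g].

(** The factors of [theta ^ 2] reach beyond [drift n ^ 2] on both sides even when theta has relative
    error [g] and the refracted square has an error of [g] times the square of the prescribed
    angle. *)
Definition gap g n :=
  Num.min (ratio n) (ratio_far n) * (1 + g) ^+ 2 + g <= (1 - g) ^+ 2 * drift n ^+ 2 /\
  drift n ^+ 2 * (1 + g) ^+ 2 + g <= (1 - g) ^+ 2 * Num.max (ratio n) (ratio_far n).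

Lemma smallE g n x : 0 < g <= 1 -> 0 < x -> 8 * x <= g * l n ->
  8 * (1 + ratio n) * x <= g -> small g n x.
Proof.
move=> /andP[g0 g1] x0 xl; rewrite /small.
move: (ratio n) (ratio_gt0 n) => M M0.
have [y yE] : exists y, y = (1 + M) * x by eexists.
move=> ?; have yg : 8 * y <= g by rewrite yE; lra.
have y0 : 0 < y by rewrite yE mulr_gt0//; lra.
have y2 : 64 * y ^+ 2 <= g.
  have -> : 64 * y ^+ 2 = (8 * y) * (8 * y) by ring.
  by apply: le_trans (_ : g * g <= g); [rewrite ler_pM//; lra|rewrite ler_piMr// ltW].
split=> //.
  apply: le_trans (_ : 4 * y ^+ 2 <= 1); last lra.
  rewrite yE !exprMn -!mulrA mulrCA; have := sqr_ge0 x.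
  suff : (1 + M) <= (1 + M) ^+ 2 by nra.
  by rewrite expr2 ler_peMr; lra.
by move: y2; rewrite yE exprMn; lra.
Qed.

(** First [g] is fixed by the finitely many nodes and by [drift_turn], then [d0] is taken small in
    terms of [g]. Since the prescribed angles shrink from turn to turn, smallness on the first turn
    suffices. *)
Lemma parameters : exists g d0 : R, [/\ 0 < g <= 1 / 8, 0 < d0,
  forall n, gap g n, (1 + 2 * g) * drift_turn <= 1 - 2 * g &
  forall n, 0 < prescribed d0 n /\ small g n (prescribed d0 n)].
Proof.
have modP (f : nat -> R) : (forall n, f (n + k) = f n) -> forall n, f n = f (n %% k)%N.
  move=> fP n; rewrite {1}(divn_eq n k); elim: (n %/ k)%N => // j IH.
  by rewrite mulSn -addnA addnC fP.
have [e1 e10 H1] : exists2 e, 0 < e & forall n g, (n < k)%N -> 0 < g <= e -> gap g n.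
  apply: unif_small => n; have [m0 ml mr] := drift_between n.
  have [e e0 He] := close_gap m0 ml; have [e' e'0 He'] := close_gap (lt_trans m0 ml) mr.
  exists (Num.min e e'); first by rewrite lt_min e0.
  move=> x; rewrite le_min => /and3P[x0 xe xe'].
  by split; [apply: He|apply: He']; apply/andP.
have Lam1 := drift_turn_lt1; have Lam0 := drift_turn_ge0.
(* The last bound yields [(1 + 2 * g) * drift_turn <= 1 - 2 * g], because [drift_turn < 1]. *)
pose g := Num.min (Num.min (1 / 8) e1) ((1 - drift_turn) / 4).
have g0 : 0 < g by rewrite !lt_min e10 !divr_gt0// subr_gt0.
have [g8 ge1 gL] : [/\ g <= 1 / 8, g <= e1 & g <= (1 - drift_turn) / 4].
  by split; rewrite !ge_min lexx ?orbT.
pose C n := \prod_(m < n) drift m.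
have C0 n : 0 < C n by rewrite prodr_gt0// => m _; exact: drift_gt0.
have [d0 d00 Hd] : exists2 e, 0 < e & forall n x, (n < k)%N -> 0 < x <= e ->
    8 * (x * C n) <= g * l n /\ 8 * (1 + ratio n) * (x * C n) <= g.
  apply: unif_small => n; have M0 := ratio_gt0 n.
  have s0 : 0 < 8 * (1 + ratio n) by rewrite mulr_gt0// addr_gt0.
  exists (Num.min (g * l n / 8 / C n) (g / (8 * (1 + ratio n)) / C n)).
    by rewrite lt_min !divr_gt0// mulr_gt0.
  move=> x; rewrite le_min !ler_pdivlMr// => /and3P[x0 ? ?]; split; lra.
exists g, d0; split=> //; first by rewrite g0.
- move=> n.
  suff : gap g (n %% k) by rewrite /gap /ratio_far /width /drift -(modP _ ratioP).
  by apply: H1; rewrite ?ltn_pmod// g0.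
- nra.
move=> n; have d_gt0 : 0 < prescribed d0 n := mulr_gt0 d00 (C0 n).
split=> //; have [h1 h2] := Hd (n %% k)%N d0 (ltn_pmod _ k_gt0) ltac:(by rewrite d00/=).
have le : prescribed d0 n <= d0 * C (n %% k)%N.
  rewrite {1}(divn_eq n k); elim: (n %/ k)%N => // j IH.
  rewrite mulSn -addnA addnC prescribedD; apply: le_trans IH.
  by apply: ler_piMl; [exact: ltW (mulr_gt0 d00 (C0 _))|exact: ltW].
apply: smallE => //; first by rewrite g0/=; lra.
  by rewrite (modP _ lP); lra.
rewrite (modP _ ratioP); apply: le_trans h2.
by rewrite ler_pM2l// mulr_gt0// addr_gt0// ratio_gt0.
Qed.

End Schedule.

(** * Realising the optional bounces *)

Lemma le_of_sqr (R : realDomainType) (x y : R) : 0 <= y -> x ^+ 2 <= y ^+ 2 -> x <= y.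
Proof. by move=> y0 h; rewrite leNgt; apply/negP => yx; nra. Qed.

Section Orbit.
Variables (R : realType) (k : nat) (r l : nat -> R).
Hypotheses (r_gt0 : forall n, 0 < r n) (l_gt0 : forall n, 0 < l n).
Hypothesis r_neq : forall n, r n != r n.+1.
Variables (g d0 : R).
Hypotheses (g_itv : 0 < g <= 1 / 8) (gapP : forall n, gap r g n).
Local Notation d := (prescribed r d0).
Hypothesis dP : forall n, 0 < d n /\ small r l g n (d n).
Implicit Types (b : nat -> bool) (u : R) (n N : nat).

Definition base n := Num.truncn (l n / (2 * d n)).
Definition bounces b n := (base n + b n)%N.

(* The trajectory leaves the start of the 0-th arc at angle u and bounces
   [bounces b n] times on the n-th arc, with the angle of incidence
   [incidence b n u]; [crossing_dir b n u] is the direction of the chord that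
   enters that arc, relative to the tangent at its starting node. *)
Fixpoint slide b n u : R * R :=
  if n is m.+1 then
    let: (c, th) := slide b m u in
    let c' := c + 2 * (bounces b m)%:R * th - l m in
    (c', refract (ratio r m) c' th)
  else (- u, u).
Definition crossing_dir b n u := (slide b n u).1.
Definition incidence b n u := (slide b n u).2.

Lemma crossing_dirS b n u : crossing_dir b n.+1 u =
  crossing_dir b n u + 2 * (bounces b n)%:R * incidence b n u - l n.
Proof. by rewrite /crossing_dir /incidence /=; case: (slide b n u). Qed.

Lemma incidenceS b n u : incidence b n.+1 u =
  refract (ratio r n) (crossing_dir b n.+1 u) (incidence b n u).
Proof. by rewrite /crossing_dir /incidence /=; case: (slide b n u). Qed.

Lemma continuous_slide b n :
  continuous (crossing_dir b n) /\ continuous (incidence b n).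
Proof.
elim: n => [|n [cc ct]].
  by split=> u; [apply: cvgN; exact: cvg_id|exact: cvg_id].
have cS : continuous (crossing_dir b n.+1).
  rewrite (_ : crossing_dir b n.+1 = fun u => crossing_dir b n u +
    2 * (bounces b n)%:R * incidence b n u - l n); last exact/funext/crossing_dirS.
  move=> u; apply: cvgB; last exact: cvg_cst.
  by apply: cvgD; [exact: cc|apply: cvgM; [exact: cvg_cst|exact: ct]].
split=> //; rewrite (_ : incidence b n.+1 = fun u =>
  refract (ratio r n) (crossing_dir b n.+1 u) (incidence b n u));
    last exact/funext/incidenceS.
exact: continuous_refract.
Qed.

Lemma eq_slide b b' n u : (forall m, (m < n)%N -> b m = b' m) ->
  slide b n u = slide b' n u.
Proof.
elim: n => [//|n IH] bb'; rewrite /= IH => [|m mn]; last exact/bb'/ltnW.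
by case: (slide b' n u) => c th; rewrite /bounces bb'.
Qed.

(** The conditions are closed in [u] and involve [b] only below [N], so that infinite trajectories
    can be constructed, and told apart, by finite prefixes. *)
Definition valid N b u := forall n, (n < N)%N ->
  0 <= crossing_dir b n.+1 u <= width r n * incidence b n u /\
  `|incidence b n u - d n| <= g * d n.

Lemma eq_valid N b b' u : (forall m, (m < N)%N -> b m = b' m) ->
  valid N b u -> valid N b' u.
Proof.
move=> bb' v n nN; have := v n nN; rewrite /crossing_dir /incidence.
rewrite (@eq_slide b b' n.+1 u) 1?(@eq_slide b b' n u)// => m mn; apply: bb'.
  exact: ltn_trans mn nN.
exact: leq_trans mn nN.
Qed.

Lemma valid_le N N' b u : (N <= N')%N -> valid N' b u -> valid N b u.
Proof. by move=> NN' v n nN; apply/v/(leq_trans nN). Qed.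

Lemma closed_valid N b : closed [set u | valid N b u].
Proof.
have cl (f : R -> R) : continuous f -> closed [set u | 0 <= f u].
  by move=> cf; apply: (@preimage_closed _ _ f [set x | 0 <= x]) => [? _|];
    [exact: cf|exact: closed_ge].
rewrite (_ : mkset _ = \bigcap_(n in [set n | (n < N)%N])
  ([set u | 0 <= crossing_dir b n.+1 u] `&`
   [set u | 0 <= width r n * incidence b n u - crossing_dir b n.+1 u] `&`
   [set u | 0 <= g * d n - `|incidence b n u - d n|])); last first.
  apply/seteqP; split=> u /= v n /v.
    by move=> [/andP[? ?] ?]; rewrite /= !subr_ge0.
  by move=> [[? +] +]; rewrite /= !subr_ge0 => ? ?; split=> //; apply/andP.
apply: closed_bigI => n _.
have [_ ct] := continuous_slide b n; have [cS _] := continuous_slide b n.+1.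
apply: closedI; first apply: closedI; apply: cl => //.
- by move=> u; apply: cvgB; [apply: cvgM; [exact: cvg_cst|exact: ct]|exact: cS].
- move=> u; apply: cvgB; first exact: cvg_cst.
  by apply: cvg_norm; apply: cvgB; [exact: ct|exact: cvg_cst].
Qed.

Lemma d_gt0 n : 0 < d n. Proof. by have [] := dP n. Qed.

Lemma base_itv n : l n / (2 * d n) - 1 < (base n)%:R <= l n / (2 * d n).
Proof.
have dd := d_gt0 n; have /truncn_itv/andP[-> +] : 0 <= l n / (2 * d n).
  by apply/ltW/divr_gt0 => //; exact: mulr_gt0.
by rewrite -natr1 andbT /base => h; lra.
Qed.

Lemma bounces_itv b n (t : R) : 0 < t ->
  l n * (t / d n) - 2 * t < 2 * (bounces b n)%:R * t <= l n * (t / d n) + 2 * t.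
Proof.
move=> t0; have dd := d_gt0 n; have /andP[lo hi] := base_itv n.
have -> : l n * (t / d n) = l n / (2 * d n) * (2 * t).
  by field; rewrite gt_eqF.
rewrite /bounces natrD; case: (b n) => /=; rewrite ?addr0; apply/andP; split; nra.
Qed.

Lemma dl n : 8 * d n <= g * l n. Proof. by have [_ []] := dP n. Qed.

Lemma bounces_gt0 b n : (0 < bounces b n)%N.
Proof.
have := dl n; have := l_gt0 n; have /andP[? ?] := g_itv; have dd := d_gt0 n.
have p : 0 < 2 * d n by lra.
by move=> *; rewrite /bounces addn_gt0 truncn_gt0 ler_pdivlMr//; apply/orP; left; nra.
Qed.

(* Along the segment [seg p q] of initial angles the trajectories are valid up
   to the n-th node, and the angle of incidence sweeps from below to above the
   prescribed one. *)
Definition sweeping b n p q :=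
  [/\ forall u, seg p q u -> valid n b u,
      forall u, seg p q u -> 0 < incidence b n u /\
        `|crossing_dir b n u| <= incidence b n u,
      incidence b n p <= (1 - g) * d n & (1 + g) * d n <= incidence b n q].

(** The chords at both ends of the arc deviate from the tangents by at most theta, so the advance
    [2 * bounces * theta] equals [l n] up to a multiple of theta. As the number of bounces is about
    [l n / (2 * d n)], theta is close to [d n]. *)
Lemma close_to_prescribed b n u : 0 < incidence b n u ->
  `|crossing_dir b n u| <= incidence b n u ->
  0 <= crossing_dir b n.+1 u <= incidence b n u ->
  `|incidence b n u - d n| <= g * d n.
Proof.
move=> t0; rewrite ler_norml => /andP[c1 c2] /andP[]; rewrite crossing_dirS => s1 s2.
have dd := d_gt0 n; have ll := l_gt0 n; have /andP[g0 g8] := g_itv.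
set t := incidence b n u in t0 c1 c2 s1 s2 *.
have /andP[lo hi] := bounces_itv b n t0.
have [x xE] : exists x, x = t / d n by eexists.
have tx : t = x * d n by rewrite xE divfK// gt_eqF.
rewrite -xE in lo hi; have dln := dl n.
move: s1 s2 lo hi; set z := 2 * _ * t => *.
have x0 : 0 < x by rewrite xE divr_gt0.
have lt4 : `|l n * (x - 1)| <= 4 * t by rewrite ler_norml; apply/andP; split; lra.
have t8 : 8 * t <= g * l n * x by rewrite tx -mulrA (mulrC x) !mulrA ler_pM2r// -mulrA.
have le : `|x - 1| <= g * x / 2.
  rewrite -(ler_pM2l ll); apply: le_trans (_ : 4 * t <= _); last by lra.
  by rewrite -[X in X * _](ger0_norm (ltW ll)) -normrM.
have -> : t - d n = (x - 1) * d n by rewrite tx; ring.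
rewrite normrM (gtr0_norm dd) ler_pM2r//; apply: (le_trans le).
move: le; rewrite ler_norml => /andP[? ?].
have : x <= 2 by nra.
by move=> x2; nra.
Qed.

Lemma node_ok b n u : 0 < incidence b n u ->
  0 <= crossing_dir b n.+1 u <= width r n * incidence b n u ->
  `|incidence b n u - d n| <= g * d n ->
  [/\ 0 < ratio r n, 0 <= crossing_dir b n.+1 u,
      crossing_dir b n.+1 u <= incidence b n u &
      (1 + ratio r n) * incidence b n u ^+ 2 <= 1].
Proof.
move=> t0 /andP[c0 cw] near; have M0 := ratio_gt0 r_gt0 n.
have /andP[w0 w1] := width_itv r_gt0 n.
split=> //; first by apply: (le_trans cw); rewrite ler_piMl// ltW.
have [_ [_ h _]] := dP n; apply: le_trans h; rewrite ler_pM2l ?addr_gt0//.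
have dd := d_gt0 n; have /andP[g0 g8] := g_itv.
have : incidence b n u <= 2 * d n by move: near; rewrite ler_norml => /andP[_]; nra.
by move=> le; apply: lerXn2r; rewrite ?nnegrE; lra.
Qed.

Lemma valid_incidence_gt0 N b u n : valid N b u -> (n < N)%N -> 0 < incidence b n u.
Proof.
move=> v nN; have [_] := v n nN; have dd := d_gt0 n; have /andP[g0 g8] := g_itv.
by rewrite ler_norml => /andP[+ _]; nra.
Qed.

Lemma valid_node N b u n : valid N b u -> (n < N)%N ->
  [/\ 0 < ratio r n, 0 <= crossing_dir b n.+1 u,
      crossing_dir b n.+1 u <= incidence b n u, 0 < incidence b n u &
      (1 + ratio r n) * incidence b n u ^+ 2 <= 1].
Proof.
move=> v nN; have [v1 v2] := v n nN; have t0 := valid_incidence_gt0 v nN.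
by have [] := node_ok t0 v1 v2.
Qed.

(** [crossing] cuts out a piece on which the next chord runs through the whole window. At its ends
    [theta ^ 2] is multiplied by about [ratio n] and [ratio_far n], and [gap] makes the new angles
    sweep across [d n.+1]. *)
Lemma sweeping_step b n p q : sweeping b n p q ->
  exists p' q', sweeping b n.+1 p' q'.
Proof.
move=> [vP tP pd qd]; have dd := d_gt0 n; have ll := l_gt0 n.
have /andP[g0 g8] := g_itv; have dln := dl n.
have /andP[w0 w1] := width_itv r_gt0 n.
have [_ ct] := continuous_slide b n; have [cS _] := continuous_slide b n.+1.
have cw : continuous (fun u => crossing_dir b n.+1 u - width r n * incidence b n u).
  by move=> u; apply: cvgB; [exact: cS|apply: cvgM; [exact: cvg_cst|exact: ct]].
have [|||p' [q' [sp sq fp fq H]]] := @crossing R _ _ p q cS cw.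
(* At [p] the angle is so small that, even with the extra bounce, the next direction is at most 0;
   at [q] it is so large that the chord overshoots the window. *)
- have [t0] := tP _ (seg_left p q); rewrite ler_norml => /andP[_ c2].
  have /andP[_ hi] := bounces_itv b n t0.
  have x1 : incidence b n p / d n <= 1 - g by rewrite ler_pdivrMr.
  rewrite crossing_dirS; move: hi; set z := 2 * _ * _ => hi; nra.
- have [t0] := tP _ (seg_right p q); rewrite ler_norml => /andP[c1 _].
  have /andP[lo _] := bounces_itv b n t0.
  have [x xE] : exists x, x = incidence b n q / d n by eexists.
  have tx : incidence b n q = x * d n by rewrite xE divfK// gt_eqF.
  have x1 : 1 + g <= x by rewrite xE ler_pdivlMr.
  rewrite -xE in lo; rewrite crossing_dirS; move: lo; set z := 2 * _ * _ => lo.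
  have wt : width r n * incidence b n q <= incidence b n q by rewrite ler_piMl// ltW.
  have : 8 * incidence b n q <= g * l n * x.
    by rewrite tx mulrCA [leRHS]mulrC ler_pM2l//; lra.
  have : g * l n <= g * l n * x by rewrite ler_peMr//; [rewrite mulr_ge0// ltW|lra].
  have : g * l n * x <= l n * (x - 1) + g * l n * x - g * l n by nra.
  nra.
- move=> u su; have [t0 _] := tP _ su; rewrite ltrBlDr ltrDl.
  exact: mulr_gt0.
have sub := seg_sub sp sq.
have win u : seg p' q' u -> 0 <= crossing_dir b n.+1 u <= width r n * incidence b n u.
  by move=> /H[? ?]; apply/andP; split=> //; rewrite -subr_le0.
have near u : seg p' q' u -> `|incidence b n u - d n| <= g * d n.
  move=> su; have [t0 c0] := tP _ (sub _ su); have /andP[h1 h2] := win _ su.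
  apply: close_to_prescribed => //; rewrite h1 (le_trans h2)//.
  by rewrite ler_piMl// ltW.
have ok u : seg p' q' u -> _ := fun su =>
  node_ok (tP _ (sub _ su)).1 (win _ su) (near _ su).
have vS u : seg p' q' u -> valid n.+1 b u.
  move=> su m; rewrite ltnS leq_eqVlt => /predU1P[->|mn]; first by split;
    [exact: win|exact: near].
  exact: vP (sub _ su) _ mn.
have tS u : seg p' q' u -> 0 < incidence b n.+1 u /\
    `|crossing_dir b n.+1 u| <= incidence b n.+1 u.
  move=> su; have [M0 h1 h2 h3] := ok u su; have [t0 _] := tP _ (sub _ su).
  rewrite incidenceS (ger0_norm h1); split; first exact: refract_gt0.
  exact: le_refract.
have dS : d n.+1 = drift r n * d n by rewrite /prescribed big_ord_recr /= mulrA [RHS]mulrC.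
(* [e] is the factor of [theta ^ 2] to leading order: [ratio n] at [p'], where [c = 0], and
   [ratio_far n] at [q'], where [c = width n * theta]. *)
have sqrE u e : seg p' q' u ->
    ratio r n * incidence b n u ^+ 2 + (1 - ratio r n) * crossing_dir b n.+1 u ^+ 2
      = e * incidence b n u ^+ 2 ->
    `|incidence b n.+1 u ^+ 2 - e * incidence b n u ^+ 2| <= g * d n ^+ 2.
  move=> su <-; have [M0 h1 h2 h3] := ok u su; have [t0 _] := tP _ (sub _ su).
  rewrite incidenceS; apply: le_trans (refract_sqr M0 h1 h2 t0 h3) _.
  have t2 : incidence b n u ^+ 4 <= 16 * d n ^+ 4.
    have -> : 16 * d n ^+ 4 = (2 * d n) ^+ 4 by ring.
    have : incidence b n u <= 2 * d n by move: (near _ su);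
      rewrite ler_norml => /andP[_]; nra.
    by move=> le; apply: lerXn2r; rewrite ?nnegrE; lra.
  have [_ [_ _ sm]] := dP n.
  apply: le_trans (_ : 2 * (1 + ratio r n) ^+ 2 * (16 * d n ^+ 4) <= _).
    by rewrite ler_pM2l// mulr_gt0// exprn_gt0// addr_gt0.
  have -> : 2 * (1 + ratio r n) ^+ 2 * (16 * d n ^+ 4) =
    (32 * (1 + ratio r n) ^+ 2 * d n ^+ 2) * d n ^+ 2 by ring.
  by rewrite ler_pM2r// exprn_gt0.
have [mn mx] := gapP n.
have Ep : `|incidence b n.+1 p' ^+ 2 - ratio r n * incidence b n p' ^+ 2| <= g * d n ^+ 2.
  by apply: sqrE (seg_left _ _) _; rewrite fp; ring.
have Eq : `|incidence b n.+1 q' ^+ 2 - ratio_far r n * incidence b n q' ^+ 2|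
  <= g * d n ^+ 2.
  apply: sqrE (seg_right _ _) _; rewrite /ratio_far; move/subr0_eq: fq => ->; ring.
have d2 : 0 < d n ^+ 2 by rewrite exprn_gt0.
have lo (e : R) u : seg p' q' u -> 0 < e ->
    `|incidence b n.+1 u ^+ 2 - e * incidence b n u ^+ 2| <= g * d n ^+ 2 ->
    e * (1 + g) ^+ 2 + g <= (1 - g) ^+ 2 * drift r n ^+ 2 ->
    incidence b n.+1 u <= (1 - g) * d n.+1.
  move=> su e0; rewrite ler_norml => /andP[_ h] he.
  have [t0 _] := tS _ su; have D0 := drift_gt0 r_gt0 n.
  apply: le_of_sqr; first by rewrite dS; apply: mulr_ge0; [lra|rewrite mulr_ge0//; lra].
  rewrite dS.
  have u2 : incidence b n u ^+ 2 <= ((1 + g) * d n) ^+ 2.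
    have [t0' _] := tP _ (sub _ su).
    have : incidence b n u <= (1 + g) * d n by move: (near _ su);
      rewrite ler_norml => /andP[_]; lra.
    by move=> le; apply: lerXn2r; rewrite ?nnegrE; lra.
  have : e * incidence b n u ^+ 2 <= e * ((1 + g) * d n) ^+ 2 by rewrite ler_pM2l.
  have := ler_wpM2r (ltW d2) he.
  lra.
have hi (e : R) u : seg p' q' u -> 0 < e ->
    `|incidence b n.+1 u ^+ 2 - e * incidence b n u ^+ 2| <= g * d n ^+ 2 ->
    drift r n ^+ 2 * (1 + g) ^+ 2 + g <= (1 - g) ^+ 2 * e ->
    (1 + g) * d n.+1 <= incidence b n.+1 u.
  move=> su e0; rewrite ler_norml => /andP[h _] he.
  have [t0 _] := tS _ su; have D0 := drift_gt0 r_gt0 n.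
  apply: le_of_sqr; first exact: ltW.
  rewrite dS.
  have u2 : ((1 - g) * d n) ^+ 2 <= incidence b n u ^+ 2.
    have [t0' _] := tP _ (sub _ su).
    have : (1 - g) * d n <= incidence b n u by move: (near _ su);
      rewrite ler_norml => /andP[+ _]; lra.
    by move=> le; apply: lerXn2r; rewrite ?nnegrE//; nra.
  have : e * ((1 - g) * d n) ^+ 2 <= e * incidence b n u ^+ 2 by rewrite ler_pM2l.
  have := ler_wpM2r (ltW d2) he.
  lra.
have [m0 m1 m2] := drift_between r_gt0 r_neq n.
(* The end with the smaller factor yields the smaller angle, so the order of the new ends depends on
   the node. *)
have [le|lt] := leP (ratio r n) (ratio_far r n).
  rewrite min_l// max_r// in m0 m1 m2 mn mx.
  exists p', q'; split=> //; first exact: lo (seg_left _ _) m0 Ep mn.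
  by apply: hi (seg_right _ _) _ Eq mx; lra.
rewrite min_r ?max_l// in m0 m1 m2 mn mx; try exact: ltW.
exists q', p'; split; rewrite 1?segC//.
  exact: lo (seg_right _ _) m0 Eq mn.
by apply: hi (seg_left _ _) _ Ep mx; lra.
Qed.

Lemma exists_valid_le b N : exists u, valid N b u.
Proof.
suff [p [q [v _ _ _]]] : exists p q, sweeping b N p q.
  by exists p; apply: v; exact: seg_left.
elim: N => [|N [p [q /sweeping_step//]]].
have d0E : d 0 = d0 by rewrite /prescribed big_ord0 mulr1.
have d00 := d_gt0 0; rewrite d0E in d00; have /andP[g0 g8] := g_itv.
(* The angle of incidence on the 0-th arc is [u] itself, so this interval sweeps across [d0]. *)
exists ((1 - g) * d0), ((1 + g) * d0); split; rewrite ?d0E// => u.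
rewrite seg_le/=; last by rewrite ler_pM2r//; lra.
rewrite in_itv/= => /andP[u1 _]; have u0 : 0 < u by apply: lt_le_trans u1;
  rewrite mulr_gt0//; lra.
by rewrite /incidence /crossing_dir/= normrN gtr0_norm.
Qed.

(** For [N >= 1] the valid initial angles form nonempty compact sets that decrease with [N]; hence
    they have a common point. *)
Lemma exists_valid b : exists u, forall N, valid N b u.
Proof.
pose K : set R := `[(1 - g) * d0, (1 + g) * d0]%classic.
have vK u : valid 1 b u -> K u.
  move=> /(_ 0 isT)[_]; rewrite /incidence/= /prescribed big_ord0 mulr1 ler_norml.
  by rewrite /K /= in_itv/= => /andP[? ?]; apply/andP; split; lra.
have := @segment_compact R ((1 - g) * d0) ((1 + g) * d0).
rewrite compact_In0 => /(_ nat setT (fun N => K `&` [set u | valid N b u]))[].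
- by exists (fun N => [set u | valid N b u]) => [N _|//]; exact: closed_valid.
- move=> D _; have [u v] := exists_valid_le b (\max_(N <- finmap.enum_fset D) N).+1.
  exists u => N ND /=; split; first exact/vK/(valid_le _ v).
  by apply: valid_le v; apply/ltnW; rewrite ltnS; exact: leq_bigmax_seq.
by move=> u uP; exists u => N; have [] := uP N I.
Qed.

(** If the codes first differed on arc [m], the chords leaving that arc would differ in direction by
    [2 * theta], whereas both directions lie between [0] and [theta]. *)
Lemma valid_inj N b b' u : valid N b u -> valid N b' u ->
  forall m, (m < N)%N -> b m = b' m.
Proof.
move=> v v'; elim/ltn_ind => m IH mN.
have E : slide b m u = slide b' m u.
  by apply: eq_slide => i im; apply: IH => //; exact: ltn_trans im mN.
have [_ + + t0 _] := valid_node v mN; have [_ + + _ _] := valid_node v' mN.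
rewrite !crossing_dirS; move: t0; rewrite /incidence /crossing_dir E.
set th := (slide b' m u).2; rewrite /bounces !natrD; case: (b m) (b' m) => -[] //=; lra.
Qed.

End Orbit.

(** * Geometry of circular polygons *)

Section CircleFacts.
Variable R : realType.
Implicit Types x y : R.

Definition turn (m : int) : R := m%:~R * (2 * pi).

Lemma turnD m n : turn (m + n) = turn m + turn n.
Proof. by rewrite /turn intrD mulrDl. Qed.

Lemma turnN m : turn (- m) = - turn m.
Proof. by rewrite /turn mulrNz mulNr. Qed.

Lemma pi_eqP x y : \pi_(circle R) x = \pi_(circle R) y <-> exists m, x - y = turn m.
Proof.
split=> [/(@eqmodP _ (angle_equiv R))/asboolP//|h].
by apply/(@eqmodP _ (angle_equiv R))/asboolP.
Qed.

Lemma repr_pi x : exists m, repr (\pi_(circle R) x) = x + turn m.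
Proof.
have /pi_eqP[m E] : \pi_(circle R) (repr (\pi_(circle R) x)) = \pi_(circle R) x
  by exact: reprK.
by exists m; rewrite -E addrC subrK.
Qed.

Lemma cos_turn x m : cos (x + turn m) = cos x.
Proof.
have H (n : nat) y : cos (y + turn n) = cos y.
  by rewrite /turn !mulr_natl (periodicn (@cosD2pi R)).
by case: m => n; [exact: H|rewrite NegzE turnN -(H n.+1) subrK].
Qed.

Lemma sin_turn x m : sin (x + turn m) = sin x.
Proof.
have H (n : nat) y : sin (y + turn n) = sin y.
  by rewrite /turn !mulr_natl (periodicn (@sinD2pi R)).
by case: m => n; [exact: H|rewrite NegzE turnN -(H n.+1) subrK].
Qed.

Lemma tangent_pi x : tangent (\pi_(circle R) x) = (- sin x, cos x).
Proof. by rewrite /tangent; have [m ->] := repr_pi x; rewrite sin_turn cos_turn. Qed.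

Lemma rotate_tangent x y :
  rotate y (tangent (\pi_(circle R) x)) = (- sin (x + y), cos (x + y)).
Proof. by rewrite tangent_pi /rotate /= sinD cosD; congr (_, _); ring. Qed.

Lemma turn_small m x y : x - y = turn m -> `|x - y| < 2 * pi -> x = y.
Proof.
move=> E; rewrite E normrM (gtr0_norm (_ : 0 < 2 * pi)) ?mulr_gt0 ?pi_gt0//.
rewrite gtr_pMl ?mulr_gt0 ?pi_gt0// -intr_norm ltrz1 => m1.
apply/eqP; rewrite -subr_eq0 E /turn; suff -> : m = 0 by rewrite mul0r.
lia.
Qed.

End CircleFacts.

(** * The unrolled polygon and its bounces *)

Section Unroll.
Variables (R : realType) (k : nat) (P : arc_chain R k).
Hypothesis k_gt0 : (0 < k)%N.
Implicit Types (n : nat) (x y th : R).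

(* The arcs are listed by the natural numbers, going round the polygon again
   and again; their angles increase by 2 pi after each turn. *)
Definition arc_index n : 'I_k := Ordinal (ltn_pmod n k_gt0).
Definition node_angle n : R := ang_start P (arc_index n) + turn R (n %/ k)%N.
Definition arc_radius n : R := Defs.radius P (arc_index n).
Definition arc_length n : R := node_angle n.+1 - node_angle n.

Lemma arc_indexS n : ordS (arc_index n) = arc_index n.+1.
Proof. by apply/val_inj; rewrite /= -[in LHS]addn1 modnDml addn1. Qed.

Lemma arc_indexP n : arc_index (n + k) = arc_index n.
Proof. by apply/val_inj; rewrite /= modnDr. Qed.

Lemma node_angleP n : node_angle (n + k) = node_angle n + 2 * pi.
Proof.
rewrite /node_angle arc_indexP divnDr// divnn k_gt0 /= PoszD turnD addrA.
by congr (_ + _); rewrite /turn mul1r.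
Qed.

Lemma node_angleM n j : node_angle (n + k * j) = node_angle n + turn R j.
Proof.
elim: j => [|j IH]; first by rewrite muln0 addn0 /turn mul0r addr0.
rewrite mulnS addnCA addnC node_angleP IH -[j.+1]addn1 PoszD turnD addrA.
by congr (_ + _); rewrite /turn mul1r.
Qed.

Lemma arc_radiusP n : arc_radius (n + k) = arc_radius n.
Proof. by rewrite /arc_radius arc_indexP. Qed.

Lemma arc_lengthP n : arc_length (n + k) = arc_length n.
Proof. by rewrite /arc_length -addSn !node_angleP; ring. Qed.

Lemma node_angleS n :
  node_angle n.+1 = ang_end P (arc_index n) + turn R (n %/ k)%N.
Proof.
rewrite ang_next /node_angle -arc_indexS -addrA; congr (_ + _).
have -> : ((arc_index n).+1 == k) = (k %| n.+1)%N.
  rewrite /= [in RHS](divn_eq n k) -addnS dvdn_addr ?dvdn_mull//.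
  apply/eqP/idP => [->//|/dvdn_leq-/(_ isT) h].
  by apply/eqP; rewrite eqn_leq h ltn_mod k_gt0.
rewrite divnS// PoszD turnD; congr (_ + _).
by case: (k %| n.+1)%N; rewrite /turn /= ?mul1r ?mul0r ?mulr1n ?mulr0n.
Qed.

Lemma node_angle_lt n : node_angle n < node_angle n.+1.
Proof. by rewrite node_angleS ltrD2r ang_lt. Qed.

Lemma node_angle_lt_mono : {mono node_angle : m n / (m < n)%N >-> m < n}.
Proof.
apply: leW_mono; apply: le_mono => m n; rewrite ltEnat /=; elim: n => // n IH.
by rewrite ltnS leq_eqVlt => /predU1P[->|/IH/lt_trans]; [|apply]; exact: node_angle_lt.
Qed.

Lemma node_angle_le_mono : {mono node_angle : m n / (m <= n)%N >-> m <= n}.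
Proof. by move=> m n; rewrite leNgt node_angle_lt_mono -leqNgt. Qed.

Lemma arc_length_gt0 n : 0 < arc_length n.
Proof. by rewrite subr_gt0 node_angle_lt. Qed.

Lemma arc_radius_gt0 n : 0 < arc_radius n. Proof. exact: radius_gt0. Qed.

Lemma on_circle_turn j x m : on_circle P j (x + turn R m) = on_circle P j x.
Proof. by rewrite /on_circle cos_turn sin_turn. Qed.

Definition on_arc n x := node_angle n <= x <= node_angle n.+1.

Lemma on_arc_turn n x : on_arc n x =
  (ang_start P (arc_index n) <= x - turn R (n %/ k)%N <= ang_end P (arc_index n)).
Proof. by rewrite /on_arc node_angleS /node_angle lerBrDr lerBlDr. Qed.

Lemma on_arc_shift n j x : on_arc (n + k * j) (x + turn R j) = on_arc n x.
Proof. by rewrite /on_arc -addSn !node_angleM !lerD2r. Qed.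

Lemma exists_arc (s : circle R) : exists n x, on_arc n x /\ \pi_(circle R) x = s.
Proof.
pose y := node_angle 0 - repr s.
have [N yN] : exists N : nat, `|y| <= turn R N.
  exists (Num.Def.archi_bound `|y|); apply: le_trans (ltW (archi_boundP (normr_ge0 y))) _.
  by rewrite /turn ler_peMr ?ler0n//; have := pi_ge2 R; lra.
pose x := repr s + turn R N.
have xs : \pi_(circle R) x = s.
  by rewrite -[RHS]reprK; apply/pi_eqP; exists N%:Z; rewrite /x addrC addKr.
have x0 : node_angle 0 <= x by move: yN; rewrite ler_norml /x /y => /andP[_]; lra.
have ex : exists n, x <= node_angle n.
  pose z := x - node_angle 0.
  exists (0 + k * Num.Def.archi_bound z)%N; rewrite node_angleM -lerBlDl.
  have z0 : 0 <= z by rewrite subr_ge0.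
  apply: le_trans (ltW (archi_boundP z0)) _.
  by rewrite /turn ler_peMr ?ler0n//; have := pi_ge2 R; lra.
case: (ex_minnP ex) => -[|n] xn minn.
  exists 0, x; split=> //; rewrite /on_arc x0/=.
  by apply: (le_trans xn); apply/ltW/node_angle_lt.
exists n, x; split=> //; rewrite /on_arc xn andbT leNgt; apply/negP => /ltW /minn.
by rewrite ltnn.
Qed.

Section Polar.
Hypothesis conc : concatenated P.

Lemma node_on_both n :
  on_circle P (arc_index n) (node_angle n.+1) =
  on_circle P (arc_index n.+1) (node_angle n.+1).
Proof.
rewrite {1}node_angleS {1}/node_angle !on_circle_turn -arc_indexS.
exact: (conc (arc_index n)).
Qed.

Lemma on_arc_agree n n' x : on_arc n x -> on_arc n' x ->
  on_circle P (arc_index n) x = on_circle P (arc_index n') x.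
Proof.
wlog nn' : n n' / (n <= n')%N.
  by move=> W a b; have [?|/ltnW ?] := leqP n n'; [exact: W|apply/esym; exact: W].
move: nn'; rewrite leq_eqVlt => /predU1P[->//|nn'] /andP[_ x1] /andP[x2 _].
have : node_angle n' <= node_angle n.+1 by exact: le_trans x2 x1.
rewrite node_angle_le_mono => n'n; have E : n' = n.+1 by apply/eqP; rewrite eqn_leq n'n.
have -> : x = node_angle n.+1 by apply/eqP; rewrite eq_le x1 -E.
by rewrite E; exact: node_on_both.
Qed.

(** Two choices of arc and angle differ by full turns and, at a node, by arcs that agree there. The
    arcs are listed by natural numbers, so a negative number of turns is moved to the other
    angle. *)
Lemma polarE n x : on_arc n x -> polar P (\pi_(circle R) x) = on_circle P (arc_index n) x.
Proof.
move=> nx; apply: xget_unique.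
  exists (arc_index n), (x - turn R (n %/ k)%N); split; first by rewrite -on_arc_turn.
    by apply/pi_eqP; exists (- (n %/ k)%:Z); rewrite turnN; ring.
  by rewrite -turnN on_circle_turn.
move=> p [j [y [jy /pi_eqP[m E] ->]]].
have ny : on_arc j y.
  rewrite on_arc_turn divn_small ?ltn_ord// /turn mul0r subr0.
  by rewrite (_ : arc_index j = j)//; apply/val_inj; rewrite /= modn_small.
have jE : arc_index j = j by apply/val_inj; rewrite /= modn_small.
have -> : on_circle P j y = on_circle P (arc_index j) y by rewrite jE.
have idxM i N : arc_index (i + k * N) = arc_index i.
  by apply/val_inj; rewrite /= addnC mulnC modnMDl.
case: m E => N E.
  have yE : y = x + turn R N by rewrite -E addrC subrK.
  rewrite (@on_arc_agree j (n + k * N)) ?idxM 1?yE ?on_arc_shift//; last by rewrite -yE.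
  by rewrite on_circle_turn.
have xE : x = y + turn R N.+1 by rewrite -[turn _ _]opprK -turnN -NegzE -E; ring.
rewrite (@on_arc_agree n (j + k * N.+1)) ?idxM 1?xE ?on_arc_shift//; last by rewrite -xE.
by rewrite on_circle_turn.
Qed.

Lemma polar_curve s : curve P (polar P s).
Proof.
have [n [x [nx <-]]] := exists_arc s; rewrite (polarE nx).
exists (arc_index n) => //; exists (x - turn R (n %/ k)%N).
  by rewrite /= in_itv/= -on_arc_turn.
by rewrite -turnN on_circle_turn.
Qed.

Section Bounce.
Hypothesis inj : injective (polar P).

(** The chord leaves in the direction [(- sin (x + th), cos (x + th))], so it suffices that the
    vector between the impact points is perpendicular to [(cos (x + th), sin (x + th))];
    [x + th = y - th'] settles the angle at the other end. *)
Lemma bounce_intro x th y th' : 0 < th < pi -> 0 < th' < pi -> x + th = y - th' ->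
  ((polar P (\pi_(circle R) y)).1 - (polar P (\pi_(circle R) x)).1) * cos (x + th) +
  ((polar P (\pi_(circle R) y)).2 - (polar P (\pi_(circle R) x)).2) * sin (x + th) = 0 ->
  bounce P (\pi_(circle R) x, th) (\pi_(circle R) y, th').
Proof.
move=> /andP[t0 t1] /andP[t0' t1'] xy.
set q := polar P _; set p := polar P _ => perp.
rewrite /bounce /= -/p -/q !rotate_tangent; split.
- by rewrite t0'.
- rewrite /p /q => /inj/pi_eqP[m E].
  have : y = x.
    by apply: turn_small E _; rewrite gtr0_norm; lra.
  lra.
- have cs := cos2Dsin2 (x + th).
  (* The component of the vector between the points along the chord direction. *)
  exists ((q.2 - p.2) * cos (x + th) - (q.1 - p.1) * sin (x + th)).
  move: p q (cos (x + th)) (sin (x + th)) perp cs => [p1 p2] [q1 q2] /= c s perp cs.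
  have cs0 : c ^+ 2 + s ^+ 2 - 1 = 0 by rewrite cs subrr.
  congr (_, _) => /=; rewrite /GRing.scale /=; apply/eqP; rewrite -subr_eq0; apply/eqP.
    transitivity (c * ((q1 - p1) * c + (q2 - p2) * s) - (q1 - p1) * (c ^+ 2 + s ^+ 2 - 1)).
      by ring.
    by rewrite perp cs0 !mulr0 subrr.
  transitivity (s * ((q1 - p1) * c + (q2 - p2) * s) - (q2 - p2) * (c ^+ 2 + s ^+ 2 - 1)).
    by ring.
  by rewrite perp cs0 !mulr0 subrr.
- rewrite tangent_pi (_ : y = x + th + th'); last by rewrite xy subrK.
  by rewrite /rotate /= (sinD (x + th)) (cosD (x + th)); congr (_, _); ring.
Qed.

Lemma bounce_in_arc n x th : 0 < th < pi -> on_arc n x -> on_arc n (x + 2 * th) ->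
  bounce P (\pi_(circle R) x, th) (\pi_(circle R) (x + 2 * th), th).
Proof.
move=> t01 nx ny; apply: bounce_intro => //; first by ring.
rewrite (polarE nx) (polarE ny) /on_circle /=.
rewrite (_ : x + 2 * th = (x + th) + th); last by ring.
have -> : cos x = cos (x + th - th) by rewrite addrK.
have -> : sin x = sin (x + th - th) by rewrite addrK.
by move: (x + th) => w; rewrite !(cosD w) !(sinD w) cosN sinN; ring.
Qed.

(* [law] computes in two ways the distance between the chord and the line
   parallel to it through the node: the distances from the chord to the two
   centers are r cos th and r' cos th', and both centers lie on the normal line
   at the node. *)
Lemma bounce_node n x th th' : 0 < th < pi -> 0 < th' < pi ->
  on_arc n x -> on_arc n.+1 (x + th + th') ->
  let c := x + th - node_angle n.+1 in
  arc_radius n.+1 * (cos c - cos th') = arc_radius n * (cos c - cos th) ->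
  bounce P (\pi_(circle R) x, th) (\pi_(circle R) (x + th + th'), th').
Proof.
move=> t01 t01' nx ny c law; apply: bounce_intro => //; first by ring.
rewrite (polarE nx) (polarE ny).
have := node_on_both n; rewrite /on_circle => -[].
rewrite -/(arc_radius n) -/(arc_radius n.+1) /=.
set b := node_angle n.+1 in c law *.
set w := x + th; rewrite (_ : x = w - th); last by rewrite /w; ring.
have cE : cos c = cos w * cos b + sin w * sin b by rewrite /c cosB.
rewrite cosB sinB cosD sinD; rewrite {}cE in law => e1 e2.
have cs := cos2Dsin2 w.
move: (Defs.center P (arc_index n)) (Defs.center P (arc_index n.+1)) e1 e2 => [u1 u2]
  [q1 q2] /= e1 e2.
have -> : q1 = u1 + arc_radius n * cos b - arc_radius n.+1 * cos b by rewrite e1; ring.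
have -> : q2 = u2 + arc_radius n * sin b - arc_radius n.+1 * sin b by rewrite e2; ring.
move: law cs; move: (cos w) (sin w) (cos b) (sin b) (cos th) (sin th) (cos th') (sin
  th') (arc_radius n) (arc_radius n.+1).
move=> cw sw cb sb ct st ct' st' r r' law cs.
transitivity ((r' * ct' - r * ct) * (cw ^+ 2 + sw ^+ 2) - (r' - r) * (cw * cb + sw *
  sb)); first ring.
rewrite cs mulr1; lra.
Qed.

End Bounce.
End Polar.
End Unroll.

(** * Smoothness of circular arcs *)

Section CircleArcSmooth.
Variable R : realType.
Implicit Types (a b s t : R).

Definition circle_arc (a1 a2 s b : R) (t : R) : plane R :=
  (a1 + s * cos (b + t), a2 + s * sin (b + t)).

Let coordE (f : R -> R) a s b t df : is_derive (b + t) 1 f df ->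
  is_derive t 1 (fun t => a + s * f (b + t) : R^o) (s * df).
Proof.
move=> d; have d' : is_derive t 1 (fun t => f (b + t)) df.
  rewrite -[df]mulr1; apply: (@is_derive1_comp _ f (fun t => b + t)) => //.
  by apply: is_derive_eq; rewrite add0r mulr1.
have := @is_deriveD _ _ _ _ _ _ _ _ _ (is_derive_cst a t 1) (is_deriveZ s d').
by rewrite add0r.
Qed.

Lemma differentiable_circle_arc a1 a2 s b t : differentiable (circle_arc a1 a2 s b) t.
Proof.
by apply: differentiable_pair; apply/derivable1_diffP; apply: ex_derive.
Qed.

(** Such parametrisations are closed under differentiation, which yields smoothness of every
    order. *)
Lemma derive1_circle_arc a1 a2 s b :
  ((circle_arc a1 a2 s b)^`())%classic = circle_arc 0 0 s (b + pi / 2).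
Proof.
apply/funext => t; rewrite derive1E deriveE; last exact: differentiable_circle_arc.
have d1 := @coordE cos a1 s b t (- sin (b + t)) _.
have d2 := @coordE sin a2 s b t (cos (b + t)) _.
have f1 : differentiable (fun t => a1 + s * cos (b + t) : R^o) t.
  by apply/derivable1_diffP; apply: ex_derive.
have f2 : differentiable (fun t => a2 + s * sin (b + t) : R^o) t.
  by apply/derivable1_diffP; apply: ex_derive.
rewrite /circle_arc diff_pair// -!deriveE// !derive_val.
rewrite addrAC [b + t + _]addrC !(addrC (pi / 2)) cosDpihalf sinDpihalf !add0r.
by [].
Qed.

Lemma Cn_circle_arc n (I : set R) a1 a2 s b : Cn_on n I (circle_arc a1 a2 s b).
Proof.
have E m : exists a1' a2' b', ((circle_arc a1 a2 s b)^`(m))%classic = circle_arc a1' a2'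
  s b'.
  elim: m => [|m [a1' [a2' [b' IH]]]]; first by exists a1, a2, b.
  by exists 0, 0, (b' + pi / 2); rewrite derive1nS IH derive1_circle_arc.
split=> [m _ t _|t _].
  have [a1' [a2' [b' ->]]] := E m.
  by apply: diff_derivable; exact: differentiable_circle_arc.
have [a1' [a2' [b' ->]]] := E n.
exact: differentiable_continuous (differentiable_circle_arc _ _ _ _ _).
Qed.

Lemma circle_arc_regular a1 a2 s b t : 0 < s ->
  ((circle_arc a1 a2 s b)^`())%classic t != 0.
Proof.
move=> s0; rewrite derive1_circle_arc; apply/eqP => -[].
rewrite !add0r => /eqP; rewrite mulf_eq0 gt_eqF//= => /eqP c0.
move=> /eqP; rewrite mulf_eq0 gt_eqF//= => /eqP s0'.
have := cos2Dsin2 (b + pi / 2 + t); rewrite c0 s0' expr0n/= addr0.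
by move/eqP; rewrite eq_sym oner_eq0.
Qed.

End CircleArcSmooth.

(** * Chords of a strictly convex curve, and unequal consecutive radii *)

Section Injectivity.
Variable R : realType.
Implicit Types (a b t th x : R) (p v : plane R).

(** A line meets the curve at most twice: of three such points the middle one would be interior to
    the convex body. *)
Lemma convex_line (G : set (plane R)) p v t t' : strictly_convex_curve G ->
  v != 0 -> G p -> G (p + t *: v) -> G (p + t' *: v) -> t != 0 -> t' != 0 -> t = t'.
Proof.
move=> [K [_ GK conv]] v0.
have three a b c : G (p + a *: v) -> G (p + b *: v) -> G (p + c *: v) ->
    a < b -> b < c -> False.
  rewrite GK => -[Ka _] [_ Kb] [Kc _] ab bc; apply: Kb.
  have ac : 0 < c - a by rewrite subr_gt0 (lt_trans ab).
  have -> : p + b *: v = ((c - b) / (c - a)) *: (p + a *: v) +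
      (1 - (c - b) / (c - a)) *: (p + c *: v).
    rewrite !scalerDr !scalerA addrACA -!scalerDl; congr (_ + _).
      by rewrite addrC subrK scale1r.
    by congr (_ *: _); field; rewrite gt_eqF.
  apply: conv => //.
    move=> /addrI/eqP; rewrite -subr_eq0 -scalerBl scaler_eq0 (negPf v0) orbF.
    by rewrite subr_eq0 => /eqP E; move: ac; rewrite E subrr ltxx.
  apply/andP; split; first by apply: divr_gt0 => //; rewrite subr_gt0.
  by rewrite ltr_pdivrMr// mul1r ltrD2l ltrN2.
rewrite -[p in G p](addr0) -(scale0r v) => G0 Gt Gt' t0 t0'.
apply/eqP; rewrite eq_le; apply/andP; split; rewrite leNgt; apply/negP => lt.
- have [h|h|h] := ltgtP t 0; last by rewrite h eqxx in t0.
    exact: three Gt' Gt G0 lt h.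
  have [h'|h'|h'] := ltgtP t' 0; last by rewrite h' eqxx in t0'.
    exact: three Gt' G0 Gt h' h.
  exact: three G0 Gt' Gt h' lt.
- have [h|h|h] := ltgtP t' 0; last by rewrite h eqxx in t0'.
    exact: three Gt Gt' G0 lt h.
  have [h'|h'|h'] := ltgtP t 0; last by rewrite h' eqxx in t0.
    exact: three Gt G0 Gt' h' h.
  exact: three G0 Gt Gt' h' lt.
Qed.

Lemma rotate_angle_inj x a b : 0 < a < pi -> 0 < b < pi ->
  rotate a (- sin x, cos x) = rotate b (- sin x, cos x) -> a = b.
Proof.
move=> /andP[a0 a1] /andP[b0 b1] [e1 e2].
apply: cos_inj; rewrite ?in_itv/= ?ltW// .
have cs := cos2Dsin2 x.
have h c : cos c = (cos c * - sin x - sin c * cos x) * - sin x +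
    (sin c * - sin x + cos c * cos x) * cos x.
  by rewrite -[LHS]mulr1 -cs; ring.
by rewrite (h a) (h b) e1 e2.
Qed.

Lemma rotate_inj a : injective (@rotate R a).
Proof.
move=> [v1 v2] [w1 w2] [e1 e2]; have cs := cos2Dsin2 a.
have h1 (z1 z2 : R) : z1 = (cos a * z1 - sin a * z2) * cos a + (sin a * z1 + cos a * z2)
  * sin a.
  by rewrite -[LHS]mulr1 -cs; ring.
have h2 (z1 z2 : R) : z2 = - (cos a * z1 - sin a * z2) * sin a + (sin a * z1 + cos a *
  z2) * cos a.
  by rewrite -[LHS]mulr1 -cs; ring.
by congr (_, _); [rewrite (h1 v1 v2) (h1 w1 w2) e1 e2|rewrite (h2 v1 v2) (h2 w1 w2) e1 e2].
Qed.

Lemma unit_neq0 x : (- sin x, cos x) != 0 :> plane R.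
Proof.
apply/eqP => -[/eqP]; rewrite oppr_eq0 => /eqP s0 c0.
by have := cos2Dsin2 x; rewrite s0 c0 expr0n addr0 => /eqP; rewrite eq_sym oner_eq0.
Qed.

Section Polygon.
Variables (k : nat) (P : arc_chain R k).
Hypotheses (k_gt0 : (0 < k)%N) (HP : circular_gon P).
Implicit Types y z : circle R * R.

Let conc : concatenated P. Proof. by case: HP => -[]. Qed.
Let inj : injective (polar P). Proof. by case: HP => -[]. Qed.
Let conv : strictly_convex_curve (curve P). Proof. by case: HP => -[]. Qed.

Lemma bounce_unique y z z' : bounce P y z -> bounce P y z' -> z = z'.
Proof.
case: y => [s th]; rewrite -[s]reprK; set x := repr s.
case: z z' => [u ph] [u' ph']; rewrite /bounce /= rotate_tangent.
move=> [ph01 pu [t tE] uE] [ph01' pu' [t' tE'] uE'].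
have cur := polar_curve k_gt0 conc.
have tt' : t = t'.
  apply: (convex_line conv (unit_neq0 (x + th)) (cur (\pi_(circle R) x))).
  - by rewrite -tE.
  - by rewrite -tE'.
  - by apply/eqP => t0; apply: pu; rewrite tE t0 scale0r addr0.
  - by apply/eqP => t0; apply: pu'; rewrite tE' t0 scale0r addr0.
have uu' : u = u' by apply: inj; rewrite tE tE' tt'.
subst u'; congr (_, _); apply: (@rotate_angle_inj (x + th)) => //.
by rewrite -uE -uE'.
Qed.

(** The final tangent and angle give the direction of the chord, and [convex_line], applied from the
    end point, gives its beginning. *)
Lemma bounce_injective y y' z : 0 < y.2 < pi -> 0 < y'.2 < pi ->
  bounce P y z -> bounce P y' z -> y = y'.
Proof.
case: y y' => [s th] [s' th']; rewrite -[s]reprK -[s']reprK.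
set x := repr s; set x' := repr s'; case: z => [u ph] /= th01 th01'.
rewrite /bounce /= !rotate_tangent.
move=> [ph01 pu [t tE] uE] [_ pu' [t' tE'] uE'].
have vv := rotate_inj (etrans (esym uE) uE').
have cur := polar_curve k_gt0 conc.
have ss : \pi_(circle R) x = \pi_(circle R) x'.
  apply: inj.
  have sE : polar P (\pi_(circle R) x) = polar P u + (- t) *: (- sin (x + th),
    cos (x + th)).
    by rewrite tE scaleNr addrK.
  have sE' : polar P (\pi_(circle R) x') = polar P u + (- t') *: (- sin (x + th),
    cos (x + th)).
    by rewrite tE' vv scaleNr addrK.
  rewrite sE sE'; congr (_ + _ *: _).
  apply: (convex_line conv (unit_neq0 (x + th)) (cur u)).
  - by rewrite -sE.
  - by rewrite -sE'.
  - by rewrite oppr_eq0; apply/eqP => t0; apply: pu; rewrite tE t0 scale0r addr0.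
  - by rewrite oppr_eq0; apply/eqP => t0; apply: pu'; rewrite tE' t0 scale0r addr0.
rewrite -ss; congr (_, _); apply: (@rotate_angle_inj x) => //.
by rewrite -!tangent_pi [in RHS]ss !rotate_tangent.
Qed.

Lemma billiard_bounce y z : 0 < y.2 < pi -> bounce P y z -> billiard P y = z.
Proof.
move=> y01 yz; rewrite /billiard y01; apply: xget_unique => // z'.
by move=> yz'; exact: bounce_unique yz' yz.
Qed.

(* If two consecutive radii agreed then so would the centers, and the curve
   would be a circular arc, in particular of class C^2, near the node. *)
Lemma arc_radius_neq n :
  arc_radius P k_gt0 n != arc_radius P k_gt0 n.+1.
Proof.
apply/eqP => rr.
have [_ /(_ (arc_index k_gt0 n))[_]] := HP; apply.
set b := node_angle P k_gt0 n.+1.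
have same x : on_circle P (arc_index k_gt0 n) x = on_circle P (arc_index k_gt0 n.+1) x.
  have := node_on_both k_gt0 conc n; rewrite /on_circle.
  rewrite -/(arc_radius P k_gt0 n) -/(arc_radius P k_gt0 n.+1) rr.
  by move=> [/addIr -> /addIr ->].
have -> : node P (arc_index k_gt0 n) = on_circle P (arc_index k_gt0 n) b.
  by rewrite /node /b node_angleS on_circle_turn.
pose gg := circle_arc (Defs.center P (arc_index k_gt0 n)).1 (Defs.center P (arc_index
  k_gt0 n)).2
  (arc_radius P k_gt0 n) b.
have len := arc_length_gt0 P k_gt0.
(* Within [e] of [b] only the two arcs at the node occur, and [e <= 1] keeps the angles distinct
   modulo full turns. *)
pose e := Num.min 1 (Num.min (arc_length P k_gt0 n) (arc_length P k_gt0 n.+1)).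
have e0 : 0 < e by rewrite !lt_min ltr01 !len.
have [e1 el el'] : [/\ e <= 1, e <= arc_length P k_gt0 n & e <= arc_length P k_gt0 n.+1].
  by split; rewrite !ge_min lexx ?orbT.
have ggE t : `|t| < e -> polar P (\pi_(circle R) (b + t)) = gg t.
  rewrite ltr_norml => /andP[t1 t2].
  have [t0|t0] := leP t 0.
    by rewrite (@polarE _ _ _ k_gt0 conc n)// /on_arc -/b; move: el;
      rewrite /arc_length -/b; lra.
  rewrite (@polarE _ _ _ k_gt0 conc n.+1) -?same// /on_arc -/b.
  by move: el'; rewrite /arc_length -/b; lra.
(* [O] is the neighbourhood of [b] modulo full turns. The image [rest] of all other angles is closed
   and, by injectivity of [polar], misses the arc near the node; its complement is the open set for
   [curve_Cn_at]. *)
pose O := \bigcup_(m in [set: int]) [set x : R | `|x - b - turn R m| < e].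
have oO : open O.
  apply: bigcup_open => m _.
  rewrite (_ : mkset _ = ball (b + turn R m) e); first exact: ball_open.
  apply/seteqP; split=> x /=; rewrite /ball /= => h.
    by rewrite distrC opprD addrA.
  by rewrite -addrA -opprD distrC.
pose rest := \bigcup_(i in [set: 'I_k]) (on_circle P i @` (`[ang_start P i,
  ang_end P i] `&` ~` O)).
have cr : closed rest.
  apply: closed_bigcup => [|i _]; first exact: finite_finset.
  apply: compact_closed; first exact: norm_hausdorff.
  apply: continuous_compact; last first.
    by apply: compact_closedI; [exact: segment_compact|exact: open_closedC].
  apply: continuous_subspaceT => x.
  rewrite (_ : on_circle P i = circle_arc (Defs.center P i).1 (Defs.center P i).2
    (Defs.radius P i) 0).
    exact: differentiable_continuous (differentiable_circle_arc _ _ _ _ _).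
  by apply/funext => y; rewrite /circle_arc add0r.
exists gg, e, (~` rest); split; split=> //.
- exact: closed_openC.
- move=> [i _ [x [xi nO] xE]]; apply: nO.
  have : polar P (\pi_(circle R) x) = polar P (\pi_(circle R) (b + 0)).
    rewrite ggE ?normr0// /gg /circle_arc addr0.
    have jE : arc_index k_gt0 i = i by apply/val_inj; rewrite /= modn_small.
    rewrite (@polarE _ _ _ k_gt0 conc i) ?jE//.
    by rewrite on_arc_turn jE divn_small// /turn mul0r subr0; move: xi; rewrite /= in_itv.
  move=> /inj/pi_eqP[m E]; exists m => //=.
  by rewrite -E addr0 subrr normr0.
- by rewrite /gg /circle_arc addr0.
- apply/seteqP; split=> [p [t + <-]|p [[i _ [x xi <-]] nr]].
    rewrite /= in_itv/= => te; have te' : `|t| < e by rewrite ltr_norml.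
    rewrite -ggE//; split; first exact: polar_curve.
    move=> [i _ [x [xi nO] xE]]; apply: nO.
    have : polar P (\pi_(circle R) x) = polar P (\pi_(circle R) (b + t)).
      have jE : arc_index k_gt0 i = i by apply/val_inj; rewrite /= modn_small.
      rewrite -xE (@polarE _ _ _ k_gt0 conc i) ?jE//.
      by rewrite on_arc_turn jE divn_small// /turn mul0r subr0; move: xi; rewrite /= in_itv.
    move=> /inj/pi_eqP[m E]; exists m => //=.
    by rewrite -E (_ : x - b - _ = t)//; ring.
  have [[m _ /= xm]|nO] := pselect (O x); last first.
    by exfalso; apply: nr; exists i => //; exists x.
  exists (x - b - turn R m); first by rewrite /= in_itv/= -ltr_norml.
  rewrite -ggE//.
  have -> : \pi_(circle R) (b + (x - b - turn R m)) = \pi_(circle R) x.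
    by apply/pi_eqP; exists (- m); rewrite turnN; ring.
  have jE : arc_index k_gt0 i = i by apply/val_inj; rewrite /= modn_small.
  rewrite (@polarE _ _ _ k_gt0 conc i) ?jE//.
  by rewrite on_arc_turn jE divn_small// /turn mul0r subr0; move: xi; rewrite /= in_itv.
- move=> t t'; rewrite !inE/= !in_itv/= => te te' E.
  have h : `|t| < e by rewrite ltr_norml.
  have h' : `|t'| < e by rewrite ltr_norml.
  move: E; rewrite -!ggE// => /inj/pi_eqP[m E].
  suff : b + t = b + t' by move/addrI.
  apply: turn_small E _.
  have := pi_ge2 R; have : `|b + t - (b + t')| <= `|t| + `|t'|.
    by rewrite (_ : b + t - (b + t') = t - t') ?ler_normB//; ring.
  lra.
- exact: Cn_circle_arc.
- by move=> t _; apply: circle_arc_regular; exact: arc_radius_gt0.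
Qed.

End Polygon.
End Injectivity.

(** * Sliding orbits and their codes *)

Section Sliding.
Variables (R : realType) (k : nat) (P : arc_chain R k).
Hypotheses (k_gt0 : (0 < k)%N) (HP : circular_gon P).
Local Notation r := (arc_radius P k_gt0).
Local Notation l := (arc_length P k_gt0).
Variables (g d0 : R).
Hypothesis g_itv : 0 < g <= 1 / 8.
Local Notation d := (prescribed r d0).
Hypothesis dP : forall n, 0 < d n /\ small r l g n (d n).
Local Notation bounces := (bounces r l d0).
Local Notation crossing_dir := (crossing_dir r l d0).
Local Notation incidence := (incidence r l d0).
Local Notation valid := (valid r l g d0).
Implicit Types (b : nat -> bool) (u : R) (n m N : nat).

Let r_gt0 := arc_radius_gt0 P k_gt0.
Let l_gt0 := arc_length_gt0 P k_gt0.
Let conc : concatenated P. Proof. by case: HP => -[]. Qed.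
Let inj : injective (polar P). Proof. by case: HP => -[]. Qed.

Let bounces_pos b n : (0 < bounces b n)%N.
Proof. have := bounces_gt0 l_gt0 g_itv dP b n. exact. Qed.

(** The entering chord meets the arc at [crossing_dir + incidence] past the node, and each bounce
    advances by twice the angle of incidence. On the 0-th arc [crossing_dir] is [- u], so the impact
    0 is the node itself. *)
Definition bounce_angle b n m u : R :=
  node_angle P k_gt0 n + crossing_dir b n u + (2 * m + 1)%:R * incidence b n u.
Definition bounce_point b n m u : circle R * R :=
  (\pi_(circle R) (bounce_angle b n m u), incidence b n u).
Definition start u : circle R * R := (\pi_(circle R) (node_angle P k_gt0 0), u).
Definition arrival b n : nat := \sum_(i < n) bounces b i.

Lemma arrivalS b n : arrival b n.+1 = (arrival b n + bounces b n)%N.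
Proof. by rewrite /arrival big_ord_recr. Qed.

Lemma arrival_le b n n' : (n <= n')%N -> (arrival b n <= arrival b n')%N.
Proof.
elim: n' => [|n' IH]; first by rewrite leqn0 => /eqP->.
rewrite leq_eqVlt ltnS => /predU1P[->//|/IH/leq_trans]; apply.
by rewrite arrivalS leq_addr.
Qed.

Lemma bounce_angle_last b n u : (0 < bounces b n)%N ->
  bounce_angle b n (bounces b n).-1 u + incidence b n u =
  node_angle P k_gt0 n.+1 + crossing_dir b n.+1 u.
Proof.
move=> c0; rewrite /bounce_angle crossing_dirS /arc_length.
rewrite -[in RHS](prednK c0); set c := (bounces b n).-1.
rewrite natrD natrM -natr1; ring.
Qed.

Section Valid.
Variables (N : nat) (b : nat -> bool) (u : R).
Hypothesis v : valid N b u.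

Lemma incidence_gt0 n : (n < N)%N -> 0 < incidence b n u.
Proof. exact: valid_incidence_gt0 v. Qed.

Lemma incidence_itv n : (n < N)%N -> 0 < incidence b n u < pi.
Proof.
move=> nN; have [M0 _ _ t0 le1] := valid_node r_gt0 g_itv dP v nN.
rewrite t0/=; apply: lt_le_trans (pi_ge2 R).
rewrite ltNge; apply/negP => le2; nra.
Qed.

Let angle_mono n m m' : (n < N)%N -> (m <= m')%N ->
  bounce_angle b n m u <= bounce_angle b n m' u.
Proof.
move=> nN mm'; rewrite lerD2l ler_pM2r ?incidence_gt0// ler_nat.
by rewrite leq_add2r leq_pmul2l.
Qed.

Lemma bounce_angle_lt n m : (n < N)%N -> (m < bounces b n)%N ->
  bounce_angle b n m u < node_angle P k_gt0 n.+1.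
Proof.
move=> nN mc; have c0 : (0 < bounces b n)%N by exact: leq_ltn_trans mc.
apply: le_lt_trans (angle_mono nN (_ : (m <= (bounces b n).-1)%N)) _.
  by rewrite -ltnS prednK.
have [/andP[_ cw] _] := v nN; have t0 := incidence_gt0 nN.
have /andP[w0 w1] := width_itv r_gt0 n.
have : width r n * incidence b n u < incidence b n u by rewrite gtr_pMl.
by have := bounce_angle_last u c0; lra.
Qed.

Lemma crossing_dir_ge0 n : (0 < n <= N)%N -> 0 <= crossing_dir b n u.
Proof. by case: n => // n nN; have [/andP[]] := v nN. Qed.

Lemma bounce_angle_gt n m : (n < N)%N -> (0 < n + m)%N ->
  node_angle P k_gt0 n < bounce_angle b n m u.
Proof.
move=> nN nm; rewrite /bounce_angle -addrA ltrDl.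
have t0 := incidence_gt0 nN.
move: nm; rewrite addn_gt0 => /orP[n0|m0].
  apply: ltr_wpDl; last by rewrite mulr_gt0// ltr0n addn1.
  by apply: crossing_dir_ge0; rewrite n0 ltnW.
have [n0|n0] := posnP n.
  subst n; change (0 < - incidence b 0 u + (2 * m + 1)%:R * incidence b 0 u).
  have : (1 <= m%:R :> R) by rewrite ler1n.
  rewrite natrD natrM; nra.
apply: ltr_wpDl; last by rewrite mulr_gt0// ltr0n addn1.
by apply: crossing_dir_ge0; rewrite n0 ltnW.
Qed.

Lemma bounce_angle_on_arc n m : (n < N)%N -> (m < bounces b n)%N ->
  on_arc P k_gt0 n (bounce_angle b n m u).
Proof.
move=> nN mc; rewrite /on_arc (ltW (bounce_angle_lt nN mc)) andbT.
have [/eqP|nm] := posnP (n + m); last exact/ltW/bounce_angle_gt.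
rewrite addn_eq0 => /andP[/eqP-> /eqP->].
by rewrite /bounce_angle /crossing_dir /incidence/= mul1r subrK.
Qed.

Lemma bounce_same_arc n m : (n < N)%N -> (m.+1 < bounces b n)%N ->
  bounce P (bounce_point b n m u) (bounce_point b n m.+1 u).
Proof.
move=> nN mc; have E : bounce_angle b n m.+1 u = bounce_angle b n m u + 2 * incidence b n u.
  by rewrite /bounce_angle -natr1 !natrD !natrM -natr1; ring.
rewrite /bounce_point E; apply: (bounce_in_arc conc inj).
- exact: incidence_itv.
- by apply: bounce_angle_on_arc => //; exact: ltnW.
- by rewrite -E; exact: bounce_angle_on_arc.
Qed.

Lemma bounce_next_arc n : (n.+1 < N)%N ->
  bounce P (bounce_point b n (bounces b n).-1 u) (bounce_point b n.+1 0 u).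
Proof.
move=> nN; have nN' := ltnW nN.
have c0 := bounces_pos b n.
have [M0 h1 h2 t0 h3] := valid_node r_gt0 g_itv dP v nN'.
have E : bounce_angle b n.+1 0 u =
    bounce_angle b n (bounces b n).-1 u + incidence b n u + incidence b n.+1 u.
  by rewrite bounce_angle_last// /bounce_angle mul1r.
rewrite /bounce_point E; apply: (bounce_node conc inj).
- exact: incidence_itv.
- exact: incidence_itv.
- by apply: bounce_angle_on_arc; rewrite ?prednK.
- by rewrite -E; apply: bounce_angle_on_arc; rewrite // bounces_pos.
rewrite bounce_angle_last// (addrC (node_angle P k_gt0 n.+1)) addrK incidenceS
  cos_refract// /node_vers /ratio.
by field; rewrite gt_eqF.
Qed.

Lemma iter_billiard n m : (n < N)%N -> (m < bounces b n)%N ->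
  iter (arrival b n + m) (billiard P) (start u) = bounce_point b n m u.
Proof.
elim: n m => [|n IHn] m nN.
  elim: m => [|m IHm] mc.
    rewrite /arrival big_ord0 /= /bounce_point /bounce_angle.
    by rewrite /crossing_dir /incidence/= mul1r subrK.
  rewrite addnS iterS IHm; last exact: ltnW.
  by apply: (billiard_bounce k_gt0 HP); [exact: incidence_itv|exact: bounce_same_arc].
elim: m => [|m IHm] mc.
  have c0 := bounces_pos b n.
  rewrite addn0 arrivalS -(prednK c0) addnS iterS IHn ?prednK//; last exact: ltnW.
  by apply: (billiard_bounce k_gt0 HP); [apply: incidence_itv;
    exact: ltnW|exact: bounce_next_arc].
rewrite addnS iterS IHm; last exact: ltnW.
by apply: (billiard_bounce k_gt0 HP); [exact: incidence_itv|exact: bounce_same_arc].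
Qed.

Lemma arrival_decomp t : (t < arrival b N)%N ->
  exists n m, [/\ (n < N)%N, (m < bounces b n)%N & t = (arrival b n + m)%N].
Proof.
elim: N => [|n IH]; first by rewrite /arrival big_ord0.
rewrite arrivalS => tn; have [/IH[n' [m [nn mc ->]]]|ge] := ltnP t (arrival b n).
  by exists n', m; split=> //; exact: ltnW.
by exists n, (t - arrival b n)%N; split=> //; [rewrite ltn_subLR|rewrite subnKC].
Qed.

Lemma iter_itv t : (t < arrival b N)%N ->
  0 < (iter t (billiard P) (start u)).2 < pi.
Proof.
by move=> /arrival_decomp[n [m [nN mc ->]]]; rewrite iter_billiard//; exact: incidence_itv.
Qed.

Lemma iter_bounce t : (t.+1 < arrival b N)%N ->
  bounce P (iter t (billiard P) (start u)) (iter t.+1 (billiard P) (start u)).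
Proof.
move=> tN; have [n [m [nN mc tE]]] := arrival_decomp (ltnW tN).
have [mc'|] := ltnP m.+1 (bounces b n).
  by rewrite tE -addnS !iter_billiard//; exact: bounce_same_arc.
move=> cm; have E : m = (bounces b n).-1.
  have := bounces_gt0 l_gt0 g_itv dP b n; move: mc cm; lia.
have tE' : t.+1 = arrival b n.+1 by rewrite tE arrivalS; move: mc cm; lia.
have nN' : (n.+1 < N)%N.
  rewrite ltn_neqAle nN andbT; apply/eqP => nE.
  by move: tN; rewrite tE' nE ltnn.
rewrite tE' -[arrival b n.+1]addn0 iter_billiard ?bounces_pos//.
by rewrite tE iter_billiard// E; exact: bounce_next_arc.
Qed.

(** Every later impact lies strictly between two consecutive nodes, whereas the start is a node,
    whatever the number of full turns. *)
Lemma iter_no_start t u' : (t < arrival b N)%N ->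
  iter t (billiard P) (start u) = start u' -> t = 0%N /\ u = u'.
Proof.
move=> tN; have [n [m [nN mc tE]]] := arrival_decomp tN.
case: t => [|t] in tN tE *; first by move=> [].
rewrite tE iter_billiard// => -[/pi_eqP[j E] _]; exfalso.
have nm : (0 < n + m)%N.
  case: n m tE {nN mc E} => [|n] [|m]//.
  by rewrite /arrival big_ord0.
have gt := bounce_angle_gt nN nm; have lt := bounce_angle_lt nN mc.
case: j E => j E.
  have E' : bounce_angle b n m u = node_angle P k_gt0 (0 + k * j).
    by rewrite node_angleM -E addrC subrK.
  rewrite E' !node_angle_lt_mono in gt lt.
  by have := leq_ltn_trans gt lt; rewrite ltnn.
have : node_angle P k_gt0 0 <= node_angle P k_gt0 n by rewrite node_angle_le_mono.
have : 0 <= turn R j.+1 by rewrite mulr_ge0// ?mulr_ge0 ?pi_ge0 ?ler0n.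
rewrite NegzE turnN in E; lra.
Qed.

End Valid.

(** By [bounce_injective] both orbits can be traced back until one of them, and by [iter_no_start]
    also the other, is at its start. *)
Lemma iter_start_inj N N' b b' u u' t t' : valid N b u -> valid N' b' u' ->
  (t < arrival b N)%N -> (t' < arrival b' N')%N ->
  iter t (billiard P) (start u) = iter t' (billiard P) (start u') ->
  t = t' /\ u = u'.
Proof.
move=> v v'; elim: t t' => [|t IH] [|t'] tN tN'.
- by move=> [].
- by move/esym/(iter_no_start v' tN') => [].
- by move/(iter_no_start v tN) => [].
move=> E; suff /IH[||-> ->] : iter t (billiard P) (start u) = iter t' (billiard P)
  (start u').
- exact: ltnW.
- exact: ltnW.
- by [].
apply: (bounce_injective k_gt0 HP (iter_itv v (ltnW tN)) (iter_itv v' (ltnW tN'))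
  (iter_bounce v tN)).
by rewrite E; exact: (iter_bounce v' tN').
Qed.

End Sliding.

(** * Codes and their marks *)

Section Codes.
Variable k : nat.
Hypothesis k_gt0 : (0 < k)%N.
Implicit Types (e : nat -> nat) (i j n L : nat).

Definition code e := e 0 = 0%N /\ forall i, (e i < e i.+1)%N.
Definition marks e n : bool := `[< exists i, n = (k * e i)%N >].

Lemma code_lt e : code e -> {mono e : i j / (i < j)%N}.
Proof.
move=> [_ ltS]; apply: leqW_mono; apply: leq_mono => i j; elim: j => // j IH.
by rewrite ltnS leq_eqVlt => /predU1P[->|/IH/ltn_trans]; [|apply]; exact: ltS.
Qed.

Lemma code_ge e i : code e -> (i <= e i)%N.
Proof. by move=> [_ ltS]; elim: i => // i IH; exact: leq_ltn_trans IH (ltS i). Qed.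

Lemma marksM e j : reflect (exists i, j = e i) (marks e (k * j)).
Proof.
apply: (iffP (asboolP _)) => -[i E]; exists i; last by rewrite E.
by move/eqP: E; rewrite eqn_pmul2l// => /eqP.
Qed.

(** A code enumerates its marked turns in increasing order. By induction the next turn of either
    code is a later turn of the other one, hence at least its next turn. *)
Lemma code_prefix L e e' : code e -> code e' ->
  (forall n, (n < k * L)%N -> marks e n = marks e' n) ->
  forall i, (e i < L)%N -> e' i = e i.
Proof.
move=> ce ce' ee'; have range f f' : code f -> code f' ->
    (forall n, (n < k * L)%N -> marks f n = marks f' n) ->
    forall i, (f i < L)%N -> exists i', f i = f' i'.
  move=> cf cf' ff' i fL; apply/marksM; rewrite -ff' ?ltn_pmul2l//.
  by apply/marksM; exists i.
elim=> [|i IH] iL; first by rewrite ce.1 ce'.1.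
have eii : e' i = e i by apply: IH; exact: ltn_trans (ce.2 i) iL.
have [i1 E1] := range _ _ ce ce' ee' _ iL.
have lt1 : (i < i1)%N by rewrite -(code_lt ce') -E1 eii; exact: ce.2.
have le1 : (e' i.+1 <= e i.+1)%N.
  by rewrite E1; move: lt1; rewrite leq_eqVlt => /predU1P[->//|h]; apply/ltnW;
    rewrite code_lt.
have ee'' n : (n < k * L)%N -> marks e' n = marks e n by move/ee'.
have [i2 E2] := range _ _ ce' ce ee'' i.+1 (leq_ltn_trans le1 iL).
have lt2 : (i < i2)%N by rewrite -(code_lt ce) -E2 -eii; exact: ce'.2.
apply/eqP; rewrite eqn_leq le1 E2 /=.
by move: lt2; rewrite leq_eqVlt => /predU1P[->//|h]; apply/ltnW; rewrite code_lt.
Qed.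

End Codes.

(** * The observed points and their return map *)

Section Visits.
Variables (R : realType) (k : nat) (P : arc_chain R k).
Hypotheses (k_gt0 : (0 < k)%N) (HP : circular_gon P).
Local Notation r := (arc_radius P k_gt0).
Local Notation l := (arc_length P k_gt0).
Variables (g d0 : R).
Hypotheses (g_itv : 0 < g <= 1 / 8).
Local Notation d := (prescribed r d0).
Hypothesis dP : forall n, 0 < d n /\ small r l g n (d n).
Local Notation bounces := (bounces r l d0).
Local Notation valid := (valid r l g d0).
Local Notation base := (base r l d0).
Local Notation arrival := (arrival P k_gt0 d0).
Local Notation start := (start P k_gt0).
Local Notation bounce_point := (bounce_point P k_gt0 d0).
Implicit Types (e : nat -> nat) (u : R) (i j n m N : nat).

Let r_gt0 := arc_radius_gt0 P k_gt0.
Let l_gt0 := arc_length_gt0 P k_gt0.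

(* The trajectory coded by e makes an extra bounce on the first arc in the
   turns e 0 = 0, e 1, e 2, ...; these turns are the ones where it is observed,
   at the fraction 1 / (digit j + 2) of that arc. *)
Definition digit j := logn 2 j.
Definition phase j := if j == 0%N then 0%N else (base (k * j) %/ (digit j + 2))%N.
Definition visit_time e i := (arrival (marks k e) (k * e i) + phase (e i))%N.
Definition visit e i u : circle R * R := iter (visit_time e i) (billiard P) (start u).
Definition coded e u := code e /\ forall N, valid N (marks k e) u.
Definition observed : set (circle R * R) :=
  [set z | exists e i u, coded e u /\ z = visit e i u].

(** [phase 0] is set to 0 so that the first visit is the start; sets of starts of coded orbits are
    then sets of observed points. *)
Lemma visit0 e u : coded e u -> visit e 0 u = start u.
Proof. by case=> -[e0 _] _; rewrite /visit /visit_time e0 muln0 /arrival big_ord0. Qed.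

Lemma phase_lt b j : (phase j < bounces b (k * j))%N.
Proof.
have b0 : (0 < base (k * j))%N.
  by have := bounces_gt0 l_gt0 g_itv dP (fun=> false) (k * j); rewrite /bounces addn0.
rewrite /phase; case: eqP => [_|_]; first exact: (bounces_gt0 l_gt0 g_itv dP b).
by apply: leq_trans (leq_addr _ _); rewrite ltn_Pdiv// addn2.
Qed.

Lemma visit_time_lt_arrival e i : (visit_time e i < arrival (marks k e) (k * e i).+1)%N.
Proof. by rewrite arrivalS ltn_add2l phase_lt. Qed.

Lemma visit_timeS e i : code e -> (visit_time e i < visit_time e i.+1)%N.
Proof.
move=> [_ ltS]; apply: leq_trans (visit_time_lt_arrival _ _) _.
apply: leq_trans (leq_addr _ _); apply: arrival_le.
by apply: leq_trans (_ : k * (e i).+1 <= _)%N; rewrite ?leq_pmul2l// mulnS; lia.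
Qed.

Lemma visit_time_mono e : code e -> {mono visit_time e : i j / (i < j)%N}.
Proof.
move=> ce; apply: leqW_mono; apply: leq_mono => i j; elim: j => // j IH.
by rewrite ltnS leq_eqVlt => /predU1P[->|/IH/ltn_trans]; [|apply]; exact: visit_timeS.
Qed.

Lemma visitE N e i u : (k * e i < N)%N -> valid N (marks k e) u ->
  visit e i u = bounce_point (marks k e) (k * e i) (phase (e i)) u.
Proof.
by move=> iN v; rewrite /visit (iter_billiard HP g_itv dP v)// phase_lt.
Qed.

Lemma coded_visitE e i u : coded e u ->
  visit e i u = bounce_point (marks k e) (k * e i) (phase (e i)) u.
Proof. by move=> [_ v]; exact: visitE (ltnSn _) (v _). Qed.

Lemma coded_inj e e' u : coded e u -> coded e' u -> e = e'.
Proof.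
move=> [ce v] [ce' v']; apply/funext => i; apply/esym.
apply: (@code_prefix k k_gt0 (e i).+1 _ _ ce ce') => // n nL.
exact: (valid_inj r_gt0 g_itv dP (v _) (v' _) nL).
Qed.

Lemma coded_iter_inj e e' u u' t t' : coded e u -> coded e' u' ->
  iter t (billiard P) (start u) = iter t' (billiard P) (start u') ->
  [/\ e = e', u = u' & t = t'].
Proof.
(* Each arc takes at least one bounce, so time [s] is reached within the first [s + 1] arcs. *)
move=> c c'; have lt (b : nat -> bool) (s : nat) : (s < arrival b s.+1)%N.
  elim: s => [|s IH]; rewrite arrivalS.
    by rewrite ltn_addl// (bounces_gt0 l_gt0 g_itv dP b).
  by rewrite -addn1 leq_add// (bounces_gt0 l_gt0 g_itv dP b).
move=> E; have [tt uu] := iter_start_inj HP g_itv dP (c.2 _) (c'.2 _) (lt _ _) (lt _ _) E.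
by subst u'; rewrite (coded_inj c c') tt.
Qed.

Lemma visit_inj e e' i i' u u' : coded e u -> coded e' u' ->
  visit e i u = visit e' i' u' -> [/\ e = e', u = u' & i = i'].
Proof.
move=> c c' /(coded_iter_inj c c')[ee uu tt]; split=> //; rewrite -ee in tt.
have [lt|lt|//] := ltngtP i i'; rewrite -(visit_time_mono c.1) tt ltnn in lt => //.
Qed.

Lemma observed_visit e i u : coded e u -> observed (visit e i u).
Proof. by move=> c; exists e, i, u. Qed.

Lemma iter_visit e i u : code e ->
  iter (visit_time e i.+1 - visit_time e i) (billiard P) (visit e i u) = visit e i.+1 u.
Proof.
by move=> ce; rewrite /visit -iterD subnK// ltnW// visit_timeS.
Qed.

Lemma observed_recurrent : recurrent (billiard P) observed.
Proof.
move=> z [e [i [u [c ->]]]]; exists (visit_time e i.+1 - visit_time e i)%N.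
  by rewrite subn_gt0 visit_timeS//; case: c.
by rewrite iter_visit; [exact: observed_visit|case: c].
Qed.

(** By [coded_iter_inj] an observed point on this orbit is a visit of the same code and initial
    angle, and the visit times increase strictly. *)
Lemma return_visit e i u : coded e u ->
  return_map (billiard P) observed (visit e i u) = visit e i.+1 u.
Proof.
move=> c; have ltS := visit_timeS i c.1.
rewrite /return_map.
suff -> : return_time (billiard P) observed (visit e i u) =
    (visit_time e i.+1 - visit_time e i)%N by apply: iter_visit; case: c.
have least m : (0 < m)%N -> observed (iter m (billiard P) (visit e i u)) ->
    (visit_time e i.+1 - visit_time e i <= m)%N.
  move=> m0 [e' [i' [u' [c']]]]; rewrite {1}/visit -iterD => /(coded_iter_inj c c')[ee
    uu tt].
  rewrite -ee in tt; rewrite leq_subLR addnC tt leqNgt visit_time_mono ?ltnS;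
    last by case: c.
  rewrite -ltnNge -(visit_time_mono c.1) -tt; lia.
have mem : observed (iter (visit_time e i.+1 - visit_time e i) (billiard P) (visit e i u)).
  by rewrite iter_visit; [exact: observed_visit|case: c].
apply: xget_unique => [|m [m0 mJ minm]]; first by split; rewrite ?subn_gt0.
apply/eqP; rewrite eqn_leq least// andbT; apply: minm => //.
by rewrite subn_gt0.
Qed.

Lemma iter_return_visit e i j u : coded e u ->
  iter j (return_map (billiard P) observed) (visit e i u) = visit e (i + j) u.
Proof.
move=> c; elim: j => [|j IH]; first by rewrite addn0.
by rewrite iterS IH return_visit// addnS.
Qed.

Lemma exists_coded e : (forall n, r n != r n.+1) -> (forall n, gap r g n) ->
  code e -> exists u, coded e u.
Proof.
move=> rn gp ce; have [u v] := exists_valid r_gt0 l_gt0 rn g_itv gp dP (marks k e).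
by exists u.
Qed.

End Visits.

(** * The coding map *)

Section FullShift.

Lemma ptws_discrete_cvg (Q : discreteTopologicalType) (F : set_system {ptws int -> Q})
    (f : {ptws int -> Q}) : Filter F ->
  (forall i : int, F [set g : {ptws int -> Q} | g i = f i]) -> F --> f.
Proof.
move=> FF h; apply/cvg_sup => i; apply/cvg_image.
  by apply/seteqP; split=> v // _; exists (fun _ => v).
move=> W Wi; exists [set g : {ptws int -> Q} | W (g i)].
  by apply: filterS (h i) => g /= ->; exact: nbhs_singleton.
by apply/seteqP; split=> [_ [g ? <-]//|v Wv]; exists (fun _ => v).
Qed.

Lemma ptws_eval_near (Q : discreteTopologicalType) (f : {ptws int -> Q}) (i : int) :
  \forall g \near f, g i = f i.
Proof.
exact: (@proj_continuous int (fun _ => Q) i f [set f i] (discrete_set1 _)).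
Qed.

Variable Q : discreteTopologicalType.
Local Notation left_shift := (@left_shift Q).

Lemma iter_left_shift n (q : {ptws int -> Q}) i : iter n left_shift q i = q (i + n%:Z).
Proof.
elim: n i => [|n IH] i; first by rewrite addr0.
by rewrite iterS /Defs.left_shift IH -addrA -PoszD add1n.
Qed.

Lemma full_subshift : subshift [set: {ptws int -> Q}].
Proof.
split; first exact: closedT.
apply/seteqP; split=> // q _; exists (fun i => q (i - 1)) => //.
by apply/funext => i; rewrite /Defs.left_shift addrK.
Qed.

Lemma full_transitive : shift_transitive [set: {ptws int -> Q}].
Proof.
move=> U V oU oV [q [_ Uq]] [p [_ Vp]].
(* [x n] agrees with [q] before [n], and its [2 * n]-fold shift agrees with [p] from [- n] on. *)
pose x (n : nat) : {ptws int -> Q} :=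
  fun i => if i < n%:Z then q i else p (i - (2 * n)%:Z).
have cx : x n @[n --> \oo] --> q.
  apply: ptws_discrete_cvg => i; exists `|i|.+1%N => // n /= ni.
  by rewrite /x ifT//; lia.
have cy : iter (2 * n) left_shift (x n) @[n --> \oo] --> p.
  apply: ptws_discrete_cvg => i; exists `|i|.+1%N => // n /= ni.
  by rewrite /= iter_left_shift /x ifF ?addrK//; apply/negbTE; lia.
have nU : \forall n \near \oo, U (x n).
  by apply: (cx U); apply: open_nbhs_nbhs.
have nV : \forall n \near \oo, V (iter (2 * n) left_shift (x n)).
  by apply: (cy V); apply: open_nbhs_nbhs.
have [n _ /(_ n.+1 (leqnSn n))[Un Vn]] := filterI nU nV.
exists (2 * n.+1)%N => //; exists (iter (2 * n.+1) left_shift (x n.+1)).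
by split=> //; exists (x n.+1).
Qed.

End FullShift.

(** The sequences with all symbols below [N] form a copy of the full shift on [N] symbols. *)
Lemma full_shift_factor N : (0 < N)%N ->
  has_full_shift_factor [set: {ptws int -> discrete_topology nat}] N.
Proof.
case: N => // N _.
pose T := discrete_topology 'I_N.+1.
exists [set q | forall i, (q i < N.+1)%N]; split=> //.
  apply/seteqP; split=> [_ [q qN <-] i|q qN]; first exact: qN.
  exists (fun i => q (i - 1)); first by move=> i; exact: qN.
  by apply/funext => i; rewrite /left_shift addrK.
exists (fun q : {ptws int -> discrete_topology nat} =>
  (fun i => inord (q i) : T) : {ptws int -> T}); split=> //.
- apply: continuous_subspaceT => q; apply: ptws_discrete_cvg => i.
  by apply: filterS (ptws_eval_near q i) => g /= ->.
- apply/seteqP; split=> // p _; exists (fun i => nat_of_ord (p i)) => /=.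
    by move=> i; exact: ltn_ord.
  by apply/funext => i; rewrite inord_val.
Qed.

(** * Closed sets in the phase space *)

Section PhaseTopology.
Variable R : realType.
Implicit Types x y : R.

Lemma turn_of_cos1 x : cos x = 1 -> exists m, x = turn R m.
Proof.
move=> cx; have p0 := pi_gt0 R.
pose m := Num.floor (x / (2 * pi)); exists m.
have /andP[lo hi] := floor_itv (x / (2 * pi)).
rewrite -/m ler_pdivlMr ?mulr_gt0// in lo; rewrite -/m ltr_pdivrMr ?mulr_gt0// intrD
  mulrDl mul1r in hi.
rewrite -/(turn R m) in lo hi.
pose y := x - turn R m.
have cy : cos y = 1 by rewrite /y -turnN cos_turn.
have [y0 y1] : 0 <= y /\ y < 2 * pi by rewrite /y; split; lra.
suff : y = 0 by move/eqP; rewrite subr_eq0 => /eqP.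
have zero (z : R) : 0 <= z -> z <= pi -> cos z = 1 -> z = 0.
  move=> z0 z1 cz; apply: cos_inj.
  - by rewrite in_itv/= z0 z1.
  - by rewrite in_itv/= lexx (ltW p0).
  - by rewrite cz cos0.
have [|gt] := leP y pi; first by move=> h; exact: zero.
have /zero : 0 <= 2 * pi - y by lra.
suff -> : cos (2 * pi - y) = 1 by move=> /(_ _ erefl) h; have := h ltac:(lra); lra.
have -> : 2 * pi - y = - (y + turn R (- 1%:Z)) by rewrite turnN /turn mul1r; ring.
by rewrite cosN cos_turn.
Qed.

(** [circle] is a quotient; closedness of compact images is pulled back along this continuous
    injection into a Hausdorff space. *)
Definition coords (z : circle R * R) : R * R * R :=
  (cos (repr z.1), sin (repr z.1), z.2).

Lemma coords_inj : injective coords.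
Proof.
move=> [s x] [t y]; rewrite /coords /= => -[c1 s1 ->]; congr (_, _).
rewrite -[s]reprK -[t]reprK; apply/pi_eqP; apply: turn_of_cos1.
by rewrite cosB c1 s1 -!expr2 cos2Dsin2.
Qed.

Lemma continuous_coords : continuous coords.
Proof.
have cc : continuous ((@cos R) \o (repr : circle R -> R) : circle R -> R).
  apply: repr_comp_continuous; first exact: continuous_cos.
  by move=> a b /eqP/pi_eqP[m E]; apply/eqP; rewrite -(subrK b a) E addrC cos_turn.
have cs : continuous ((@sin R) \o (repr : circle R -> R) : circle R -> R).
  apply: repr_comp_continuous; first exact: continuous_sin.
  by move=> a b /eqP/pi_eqP[m E]; apply/eqP; rewrite -(subrK b a) E addrC sin_turn.
move=> z.
have c1 : cos (repr y.1) @[y --> z] --> cos (repr z.1).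
  exact: (@continuous_comp _ _ _ fst _ z (@cvg_fst _ _ _ _ _) (cc _)).
have c2 : sin (repr y.1) @[y --> z] --> sin (repr z.1).
  exact: (@continuous_comp _ _ _ fst _ z (@cvg_fst _ _ _ _ _) (cs _)).
apply: (@cvg_pair _ _ _ (nbhs z) (nbhs (cos (repr z.1), sin (repr z.1))) (nbhs z.2)
  _ _ _ (fun z => (cos (repr z.1), sin (repr z.1))) snd); last exact: cvg_snd.
exact: (@cvg_pair _ _ _ (nbhs z) (nbhs (cos (repr z.1))) (nbhs (sin (repr z.1)))).
Qed.

Lemma closed_phase_image (f : R -> circle R * R) (K : set R) :
  continuous f -> compact K -> closed (f @` K).
Proof.
move=> cf cK.
have -> : f @` K = coords @^-1` ((coords \o f) @` K).
  apply/seteqP; split=> [_ [u Ku <-]|z [u Ku /coords_inj <-]]; last by exists u.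
  by exists u.
apply: preimage_closed => [z _|]; first exact: continuous_coords.
apply: compact_closed; first exact: norm_hausdorff.
apply: continuous_compact => //; apply: continuous_subspaceT => u.
by apply: continuous_comp; [exact: cf|exact: continuous_coords].
Qed.

End PhaseTopology.

(** * Local constancy of the code and the semiconjugacy *)

Section Coding.
Variables (R : realType) (k : nat) (P : arc_chain R k).
Hypotheses (k_gt0 : (0 < k)%N) (HP : circular_gon P).
Local Notation r := (arc_radius P k_gt0).
Local Notation l := (arc_length P k_gt0).
Variables (g d0 : R).
Hypotheses (g_itv : 0 < g <= 1 / 8) (d0_gt0 : 0 < d0) (gapP : forall n, gap r g n).
Hypothesis turnP : (1 + 2 * g) * drift_turn k r <= 1 - 2 * g.
Local Notation d := (prescribed r d0).
Hypothesis dP : forall n, 0 < d n /\ small r l g n (d n).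
Local Notation valid := (valid r l g d0).
Local Notation bounce_point := (bounce_point P k_gt0 d0).
Local Notation phase := (phase P k_gt0 d0).
Local Notation visit := (visit P k_gt0 d0).
Local Notation coded := (coded P k_gt0 g d0).
Local Notation observed := (observed P k_gt0 g d0).
Implicit Types (e : nat -> nat) (u : R) (i j n m N L : nat) (b : nat -> bool).

Let r_gt0 := arc_radius_gt0 P k_gt0.
Let l_gt0 := arc_length_gt0 P k_gt0.
Let r_neq := arc_radius_neq k_gt0 HP.
Let rP := arc_radiusP P k_gt0.

Lemma visit_itv e i u : coded e u -> 0 < (visit e i u).2 < pi.
Proof.
move=> c; rewrite (coded_visitE HP g_itv dP)//.
exact: (incidence_itv g_itv dP (c.2 _) (ltnSn _)).
Qed.

Lemma visit_strip e i u : coded e u ->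
  `|(visit e i u).2 - d (k * e i)| <= g * d (k * e i).
Proof.
move=> c; rewrite (coded_visitE HP g_itv dP)//.
by have [_] := c.2 _ _ (ltnSn (k * e i)).
Qed.

Lemma prescribed_turn i j : (i < j)%N -> d (k * j) <= drift_turn k r * d (k * i).
Proof.
move=> ij; rewrite !(prescribedM rP) mulrA -exprS ler_pM2r//.
apply: ler_wiXn2l => //; first exact: drift_turn_ge0.
exact/ltW/drift_turn_lt1.
Qed.

(** [turnP] keeps the strips of relative width [2 * g] about the prescribed angles of different
    turns apart, so the angle tells the turn. *)
Lemma strip_unique i j (x : R) : `|x - d (k * i)| <= g * d (k * i) ->
  `|x - d (k * j)| < 2 * g * d (k * j) -> i = j.
Proof.
rewrite ler_norml ltr_norml => /andP[i1 i2] /andP[j1 j2].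
have Lam0 := drift_turn_ge0 k r_gt0; have di := (dP (k * i)).1; have dj := (dP (k * j)).1.
have /andP[g0 g8] := g_itv; have tP := turnP.
have [/prescribed_turn h|/prescribed_turn h|//] := ltngtP i j; exfalso.
  have : (1 + 2 * g) * d (k * j) <= (1 + 2 * g) * (drift_turn k r * d (k * i)).
    by rewrite ler_wpM2l//; lra.
  have : (1 + 2 * g) * drift_turn k r * d (k * i) <= (1 - 2 * g) * d (k * i).
    by rewrite ler_wpM2r// ltW.
  have : 0 < g * d (k * i) by rewrite mulr_gt0.
  lra.
have : (1 + 2 * g) * d (k * i) <= (1 + 2 * g) * (drift_turn k r * d (k * j)).
  by rewrite ler_wpM2l//; lra.
have : (1 + 2 * g) * drift_turn k r * d (k * j) <= (1 - 2 * g) * d (k * j).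
  by rewrite ler_wpM2r// ltW.
have : 0 < g * d (k * i) by rewrite mulr_gt0.
lra.
Qed.

Definition pad N (b : {ffun 'I_N -> bool}) n : bool := oapp b false (insub n).

Lemma padE N (b : nat -> bool) n : (n < N)%N -> pad [ffun i : 'I_N => b i] n = b n.
Proof. by move=> nN; rewrite /pad insubT/= ffunE. Qed.

Definition initial_angles : set R := `[0, 2 * d0]%classic.

Lemma valid_initial N b u : (0 < N)%N -> valid N b u -> initial_angles u.
Proof.
move=> N0 v; have [_] := v _ N0; rewrite /prescribed big_ord0 mulr1 /incidence/= ler_norml.
have /andP[g0 g8] := g_itv; have d0' := d0_gt0.
by move=> /andP[? ?]; rewrite /initial_angles/= in_itv/=; apply/andP; split; nra.
Qed.

Lemma compact_valid N b : compact (initial_angles `&` [set u | valid N b u]).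
Proof. by apply: compact_closedI; [exact: segment_compact|exact: closed_valid]. Qed.

Lemma continuous_bounce_point b n m : continuous (bounce_point b n m).
Proof.
have [cc ct] := continuous_slide r l d0 b n.
have ca : continuous (bounce_angle P k_gt0 d0 b n m).
  move=> u; apply: cvgD; first by apply: cvgD; [exact: cvg_cst|exact: cc].
  by apply: cvgM; [exact: cvg_cst|exact: ct].
move=> u; apply: (@cvg_pair _ _ _ (nbhs u) (nbhs (bounce_point b n m u).1)
  (nbhs (incidence r l d0 b n u))); last exact: ct.
by apply: (@continuous_comp R R (circle R) _ _ u (ca u)); exact: pi_continuous.
Qed.

Lemma eq_bounce_point b b' n m u : (forall i, (i < n)%N -> b i = b' i) ->
  bounce_point b n m u = bounce_point b' n m u.
Proof.
move=> bb'; rewrite /bounce_point /bounce_angle /crossing_dir /incidence.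
by rewrite (eq_slide _ _ _ _ bb').
Qed.

(** The angle fixes the turn [j], and with it the phase. The points of turn [j] whose prefix differs
    from that of [e] form a finite union [Z] of compact images, which misses the given visit by
    injectivity. *)
Lemma near_visit_marks e i u L : coded e u ->
  \forall z \near visit e i u, forall e' i' u', coded e' u' -> z = visit e' i' u' ->
  e' i' = e i /\ forall n, (n < k * L)%N -> marks k e' n = marks k e n.
Proof.
(* [N] exceeds both [k * j], the arc of the visit, and the length [k * L] to be compared. *)
move=> c; pose j := e i; pose N := (k * (L + j.+1))%N.
have jN : (k * j < N)%N by rewrite ltn_pmul2l// addnS ltnS leq_addl.
have N0 : (0 < N)%N by exact: leq_ltn_trans jN.
pose D := [set b : {ffun 'I_N -> bool} | exists2 n, (n < N)%N & pad b n <> marks k e n].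
pose Z := \bigcup_(b in D) (bounce_point (pad b) (k * j) (phase j) @`
  (initial_angles `&` [set u | valid N (pad b) u])).
have cZ : closed Z.
  apply: closed_bigcup => [|b _]; first exact: finite_finset.
  apply: closed_phase_image; first exact: continuous_bounce_point.
  exact: compact_valid.
have nZ : ~ Z (visit e i u).
  move=> [b [n nN bn] [u' [_ v'] E]]; apply: bn.
  rewrite -(iter_billiard HP g_itv dP v') ?(phase_lt g_itv dP)// in E.
  have lt1 : (arrival P k_gt0 d0 (pad b) (k * j) + phase j < arrival P k_gt0 d0 (pad b)
    N)%N.
    apply: leq_trans (arrival_le _ _ _ _ jN); rewrite arrivalS ltn_add2l.
    exact: (phase_lt g_itv dP).
  have lt2 : (visit_time P k_gt0 d0 e i < arrival P k_gt0 d0 (marks k e) N)%N.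
    apply: leq_trans (arrival_le _ _ _ _ jN).
    exact: (visit_time_lt_arrival g_itv dP).
  have [_ uu] := iter_start_inj HP g_itv dP v' (c.2 N) lt1 lt2 E.
  rewrite uu in v'; exact: (valid_inj r_gt0 g_itv dP v' (c.2 N) nN).
have nearZ : \forall z \near visit e i u, ~ Z z.
  by apply: open_nbhs_nbhs; split=> //; exact: closed_openC.
have g_gt0 : 0 < g by case/andP: g_itv.
have nearS : \forall z \near visit e i u, `|z.2 - d (k * j)| < 2 * g * d (k * j).
  have o : open [set x : R | `|x - d (k * j)| < 2 * g * d (k * j)].
    rewrite (_ : mkset _ = ball (d (k * j)) (2 * g * d (k * j))); first exact: ball_open.
    by apply/seteqP; split=> x /=; rewrite /ball /= distrC.
  have : nbhs (visit e i u).2 [set x : R | `|x - d (k * j)| < 2 * g * d (k * j)].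
    apply: open_nbhs_nbhs; split=> //=; apply: le_lt_trans (visit_strip i c) _.
    by rewrite -mulrA ltr_pMl ?ltr1n// mulr_gt0// (dP _).1.
  exact: (@cvg_snd _ _ _ _ _).
apply: filterS (filterI nearZ nearS) => z [zZ zS] e' i' u' c' zE.
have ij : e' i' = j.
  by apply: strip_unique (visit_strip i' c') _; rewrite -zE.
split=> // n nL; have nN : (n < N)%N.
  by apply: leq_trans nL _; rewrite leq_pmul2l// leq_addr.
have [//|ne] := pselect (marks k e' n = marks k e n).
exfalso; apply: zZ; exists [ffun i : 'I_N => marks k e' i].
  by exists n => //; rewrite padE.
exists u'.
  have v' : valid N (pad [ffun i : 'I_N => marks k e' i]) u'.
    by apply: eq_valid (c'.2 N) => m mN; rewrite padE.
  by split=> //; exact: valid_initial (c'.2 N).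
rewrite zE (coded_visitE HP g_itv dP)// ij; apply: eq_bounce_point => m mj.
by rewrite padE// (ltn_trans mj).
Qed.

Lemma near_visit_code e i u m : coded e u ->
  \forall z \near visit e i u, forall e' i' u', coded e' u' -> z = visit e' i' u' ->
  i' = i /\ forall q, (q <= m)%N -> e' q = e q.
Proof.
(* The prefix has to contain turn [e m], for the entries up to [m], and turn [e i], for the index of
   the visit. *)
move=> c; apply: filterS (near_visit_marks i (maxn (e m) (e i)).+1 c).
move=> z H e' i' u' c' /(H _ _ _ c')[ii ee].
have pre q : (e q < (maxn (e m) (e i)).+1)%N -> e' q = e q.
  apply: (code_prefix k_gt0 c.1 c'.1) => n nL.
  by rewrite ee.
split.
  have lt := code_lt c'.1.
  have E : e' i' = e' i by rewrite ii pre// ltnS leq_maxr.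
  by have [h|h|//] := ltngtP i' i; move: h; rewrite -lt E ltnn.
move=> q qm; apply: pre; rewrite ltnS leq_max; apply/orP; left.
by rewrite leqNgt (code_lt c.1) -leqNgt.
Qed.

Local Notation symbols := (discrete_topology nat).

(* [pickle] injects int into nat, so that the coordinates of negative index are
   also read off the future of the orbit; the past of an observed point carries
   no information, because observed orbits never return to their start. *)
Definition itinerary e i : {ptws int -> symbols} :=
  fun a => digit (e (pickle (a + i%:Z)).+1).

(** A code and an index are chosen classically; [visit_inj] makes the choice unambiguous on
    [observed], and elsewhere the value is a default. *)
Definition coding (z : circle R * R) : {ptws int -> symbols} :=
  if pselect (exists p : (nat -> nat) * nat * R,
      coded p.1.1 p.2 /\ z = visit p.1.1 p.1.2 p.2) is left ex
  then itinerary (projT1 (cid ex)).1.1 (projT1 (cid ex)).1.2 else fun _ => 0%N.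

Lemma coding_visit e i u : coded e u -> coding (visit e i u) = itinerary e i.
Proof.
move=> c; rewrite /coding; case: pselect => [ex|[]]; last by exists (e, i, u).
case: cid => -[[e' i'] u'] /= [c' /esym/(visit_inj HP g_itv dP c' c)[-> _ ->]].
by [].
Qed.

Lemma continuous_coding : {within observed, continuous coding}.
Proof.
apply/subspace_continuousP => _ [e [i [u [c ->]]]].
rewrite /from_subspace (coding_visit i c).
apply: ptws_discrete_cvg => a.
rewrite /within /=; apply: filterS (near_visit_code i (pickle (a + i%:Z)).+1 c).
move=> z H [e' [i' [u' [c' zE]]]]; have [ii ee] := H _ _ _ c' zE.
by rewrite /= zE (coding_visit i' c') /itinerary ii ee.
Qed.

Lemma itineraryS e i : itinerary e i.+1 = left_shift (itinerary e i).
Proof.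
by apply/funext => a; rewrite /left_shift /itinerary -addrA -PoszD add1n.
Qed.

(** Each entry is an odd multiple of [2 ^ s m] and exceeds the previous one, so any sequence [s]
    occurs as the sequence of valuations. *)
Fixpoint code_of (s : nat -> nat) n : nat :=
  if n is m.+1 then 2 ^ s m * (2 * code_of s m).+1 else 0.

Lemma code_code_of s : code (code_of s).
Proof.
split=> // i /=; have : (0 < 2 ^ s i)%N by rewrite expn_gt0.
by set p := (2 ^ s i)%N; nia.
Qed.

Lemma digit_code_of s n : digit (code_of s n.+1) = s n.
Proof.
rewrite /digit /= lognM ?expn_gt0// pfactorK// lognE /= dvdn2 /= mul2n odd_double.
by rewrite addn0.
Qed.

Lemma semiconjugate_coding :
  semiconjugate observed (return_map (billiard P) observed)
    [set: {ptws int -> symbols}] (@left_shift symbols).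
Proof.
exists coding; split; first exact: continuous_coding.
  apply/seteqP; split=> // q _.
  (* A number that encodes no integer gets the symbol 0. *)
  pose s n := odflt 0%N (omap q (unpickle n)).
  have [u c] := exists_coded g_itv dP r_neq gapP (code_code_of s).
  exists (visit (code_of s) 0 u); first exact: observed_visit.
  rewrite (coding_visit 0 c); apply/funext => a.
  by rewrite /itinerary digit_code_of addr0 /s pickleK.
move=> _ [e [i [u [c ->]]]].
by rewrite (return_visit HP g_itv dP)// !coding_visit// itineraryS.
Qed.

Lemma observed_phase_space : observed `<=` @phase_space R.
Proof.
move=> _ [e [i [u [c ->]]]]; have /andP[h0 h1] := visit_itv i c.
by rewrite /phase_space /= !ltW.
Qed.

Lemma circle_dist0 (s : circle R) : circle_dist s s = 0.
Proof.
apply/eqP; rewrite eq_le; apply/andP; split.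
  apply: ge_inf; first by exists 0 => _ [m _ <-].
  by exists 0 => //; rewrite subrr mul0r addr0 normr0.
apply: lb_le_inf; first by exists `|repr s - repr s + 0%:~R * (2 * pi)|, 0.
by move=> _ [m _ <-].
Qed.

Lemma prescribed_small (eps : R) : 0 < eps ->
  exists n, forall j, (n <= j)%N -> d (k * j) < eps.
Proof.
move=> eps0.
have Lam1 := drift_turn_lt1 k_gt0 r_gt0 rP r_neq; have Lam0 := drift_turn_ge0 k r_gt0.
have /cvgrPdist_lt/(_ (eps / d0)) : drift_turn k r ^+ n @[n --> \oo] --> 0.
  by apply: cvg_expr; rewrite ger0_norm.
rewrite divr_gt0// => /(_ isT)[n _ H]; exists n => j /H.
by rewrite (prescribedM rP) sub0r normrN ger0_norm ?exprn_ge0// ltr_pdivlMr.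
Qed.

Lemma observed_clusters : clusters_at_boundary observed.
Proof.
move=> eps eps0; pose e := code_of (fun _ => 0%N).
have ce : code e := code_code_of _.
have [u c] := exists_coded g_itv dP r_neq gapP ce.
have [n Hn] := prescribed_small (divr_gt0 eps0 (ltr0n R 2)).
(* In turn [e n >= n] the angle is at most [1 + g] times the prescribed one; the boundary point has
   the same position. *)
exists (visit e n u), ((visit e n u).1, 0).
have [th0 th1] := andP (visit_itv n c).
split; first exact: observed_visit.
- by case=> E; [move: th0|move: th1]; rewrite E ltxx.
- by left.
rewrite /phase_dist /= circle_dist0 expr0n/= add0r subr0 sqrtr_sqr gtr0_norm//.
have := visit_strip n c; rewrite ler_norml => /andP[_].
have := Hn _ (code_ge n ce); have /andP[g0 g8] := g_itv; have := (dP (k * e n)).1.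
nra.
Qed.

End Coding.

(** * Entropy *)

Section Entropy.
Variables (R : realType) (X : topologicalType) (dist : X -> X -> R) (F : X -> X).
Local Open Scope ereal_scope.

Lemma le_limn_esup (u v : (\bar R)^nat) : (forall n, u n <= v n) ->
  limn_esup u <= limn_esup v.
Proof.
move=> uv; rewrite !limn_esup_lim; apply: lee_lim; [exact: is_cvg_esups..|].
apply: nearW => n; apply: ge_ereal_sup => _ [m nm <-].
by apply: le_ereal_sup_tmp; exists (v m) => //; exists m.
Qed.

Lemma limn_esup_ge (u : (\bar R)^nat) c : (\forall n \near \oo, c <= u n) ->
  c <= limn_esup u.
Proof.
move=> [N _ cu]; rewrite limn_esup_lim; apply: lime_ge; first exact: is_cvg_esups.
apply: nearW => n; apply: le_ereal_sup_tmp; exists (u (maxn n N)).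
  by exists (maxn n N) => //=; rewrite leq_maxl.
by apply: cu; rewrite /= leq_maxr.
Qed.

Lemma max_separated_ge0 n e K : 0 <= max_separated dist F n e K.
Proof.
apply: le_ereal_sup_tmp; exists 0 => //; exists set0; last by rewrite fset_set0.
by split=> // x y.
Qed.

Lemma max_separated_anti n K (e e' : R) : (e <= e')%R ->
  max_separated dist F n e' K <= max_separated dist F n e K.
Proof.
move=> ee'; apply: ereal_sup_le => _ [E [fE EK sE] <-]; exists E => //; split=> //.
move=> x y Ex Ey xy; have [i ni di] := sE x y Ex Ey xy.
by exists i => //; exact: le_lt_trans di.
Qed.

Let growth K (e : R) := limn_esup (fun n => (n%:R^-1)%:E * lne (max_separated dist F n e
  K)).

Let growth_anti K (e e' : R) : (e <= e')%R -> growth K e' <= growth K e.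
Proof.
move=> ee'; apply: le_limn_esup => n; apply: lee_wpmul2l.
  by rewrite lee_fin invr_ge0.
rewrite lee_lne ?in_itv/= ?max_separated_ge0 ?leey//.
exact: max_separated_anti.
Qed.

(** The growth rate does not decrease as the scale shrinks, so the limit at 0 is the supremum over
    all scales. *)
Lemma growth_le_entropy K e : (0 < e)%R -> growth K e <= bowen_entropy_on dist F K.
Proof.
move=> e0; rewrite /bowen_entropy_on -/(growth K).
have := @nonincreasing_at_right_cvge R (growth K) 0%R (BInfty R false) isT.
move=> /(_ (fun x y _ _ => @growth_anti K x y))/cvg_lim -> //.
by apply: ereal_sup_ubound; exists e => //=; rewrite in_itv/= e0.
Qed.

Lemma card_range (T : finType) (f : T -> X) : injective f ->
  size (finmap.enum_fset (fset_set (range f))) = #|T|.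
Proof.
move=> fi; rewrite fset_set_image; last exact: finite_finset.
rewrite finmap.card_in_imfset; last by move=> x y _ _; exact: fi.
rewrite cardT; apply/perm_size/uniq_perm; [exact: finmap.fset_uniq|exact: enum_uniq|].
by move=> x; rewrite mem_enum in_fset_set ?in_setT; last exact: finite_finset.
Qed.

(** Words of length [n - 1] give [M ^ (n - 1)] points separated within [n] steps; the factor 1/2
    comes from [(n - 1) / n >= 1 / 2] for [n >= 2]. *)
Lemma entropy_ge (K : set X) (e : R) M : (0 < e)%R -> (0 < M)%N ->
  (forall n, exists f : {ffun 'I_n -> 'I_M} -> X,
    [/\ injective f, forall w, K (f w) & forall w w', w <> w' ->
      exists2 i, (i < n.+1)%N & (e < dist (iter i F (f w)) (iter i F (f w')))%R]) ->
  (ln (M%:R : R) / 2)%:E <= bowen_entropy_on dist F K.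
Proof.
move=> e0 M0 H; apply: le_trans (growth_le_entropy K e0); apply: limn_esup_ge.
exists 2%N => // n /= n2; have [f [fi fK fs]] := H n.-1.
have nE : n.-1.+1 = n by rewrite prednK// ltnW.
rewrite nE in fs.
have big : ((M ^ n.-1)%:R)%:E <= max_separated dist F n e K.
  apply: le_ereal_sup_tmp; exists (#|{ffun 'I_n.-1 -> 'I_M}|%:R)%:E; last first.
    by rewrite card_ffun !card_ord.
  exists (range f); last by rewrite card_range.
  split=> [|_ [w _ <-]|_ _ [w _ <-] [w' _ <-] ww']; last 2 first.
  - exact: fK.
  - by apply: fs => E; apply: ww'; rewrite E.
  by apply: finite_image; exact: finite_finset.
have M1 : (0 < (M%:R : R))%R by rewrite ltr0n.
apply: le_trans (_ : (n%:R^-1)%:E * lne ((M ^ n.-1)%:R)%:E <= _); last first.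
  apply: lee_wpmul2l; first by rewrite lee_fin invr_ge0.
  rewrite lee_lne ?in_itv/= ?max_separated_ge0 ?leey//.
  by rewrite lee_fin ler0n.
rewrite lne_EFin ?ltr0n ?expn_gt0 ?M0// -EFinM lee_fin natrX lnXn//.
have L0 : (0 <= ln (M%:R : R))%R by rewrite ln_ge0// ler1n.
rewrite -(mulr_natr (ln _)) mulrCA ler_wpM2l//.
have -> : (n%:R^-1 = n.-1.+1%:R^-1 :> R)%R by rewrite nE.
have n1 : (1 <= n.-1%:R :> R)%R by rewrite ler1n -ltnS nE.
by rewrite mulrC ler_pdivlMr ?ltr0n// -[n.-1.+1%:R](natr1 n.-1) mulrDr mulr1; lra.
Qed.

End Entropy.

(** * Infinite entropy of the return map *)

Section EntropyOfReturnMap.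
Variables (R : realType) (k : nat) (P : arc_chain R k).
Hypotheses (k_gt0 : (0 < k)%N) (HP : circular_gon P).
Local Notation r := (arc_radius P k_gt0).
Local Notation l := (arc_length P k_gt0).
Variables (g d0 : R).
Hypotheses (g_itv : 0 < g <= 1 / 8) (d0_gt0 : 0 < d0) (gapP : forall n, gap r g n).
Local Notation d := (prescribed r d0).
Hypothesis dP : forall n, 0 < d n /\ small r l g n (d n).
Local Notation valid := (valid r l g d0).
Local Notation visit := (visit P k_gt0 d0).
Local Notation coded := (coded P k_gt0 g d0).
Local Notation observed := (observed P k_gt0 g d0).
Local Notation start := (start P k_gt0).
Local Notation incidence := (incidence r l d0).
Local Notation crossing_dir := (crossing_dir r l d0).
Implicit Types (e : nat -> nat) (u x y : R) (i j n m N L : nat).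

Let r_gt0 := arc_radius_gt0 P k_gt0.
Let l_gt0 := arc_length_gt0 P k_gt0.
Let r_neq := arc_radius_neq k_gt0 HP.
Let rP := arc_radiusP P k_gt0.

Lemma circle_dist_ge x y (D : R) : D <= `|x - y| -> `|x - y| <= 2 * pi - D ->
  D <= circle_dist (\pi_(circle R) x) (\pi_(circle R) y).
Proof.
move=> D1 D2; apply: lb_le_inf.
  by exists `|repr (\pi_(circle R) x) - repr (\pi_(circle R) y) + 0%:~R * (2 * pi)|, 0.
move=> _ [m _ <-]; have [a ->] := repr_pi x; have [b ->] := repr_pi y.
rewrite -/(turn R m).
have -> : x + turn R a - (y + turn R b) + turn R m = x - y + turn R (a - b + m).
  by rewrite !turnD turnN; ring.
have [->|c0] := eqVneq (a - b + m) 0; first by rewrite /turn mul0r addr0.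
(* Adding a nonzero number of turns leaves a distance of at least [2 * pi] minus that of [x] and
   [y], hence at least [D]. *)
have c1 : 2 * pi <= `|turn R (a - b + m)|.
  rewrite normrM -intr_norm (gtr0_norm (_ : 0 < 2 * pi)) ?mulr_gt0 ?pi_gt0//.
  rewrite ler_peMl ?mulr_ge0 ?pi_ge0//.
  by rewrite (_ : 1 = 1%:~R) // ler_int; lia.
move: (turn R _) c1 => t c1; have := ler_normB (x - y + t) (x - y).
by rewrite (_ : x - y + t - (x - y) = t); [lra|ring].
Qed.

(** In a visited turn [base + 1] bounces cover the first arc up to a multiple of the angle of
    incidence, so the visit after [base %/ (digit + 2)] bounces is at the fraction [1 / (digit + 2)]
    up to such an error. *)
Lemma visit_angle e i u : coded e u -> (0 < i)%N ->
  exists x, (visit e i u).1 = \pi_(circle R) (node_angle P k_gt0 0 + x) /\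
    `|x - l 0 / (digit (e i) + 2)%:R| <= 12 * d (k * e i).
Proof.
move=> c i0; have ei0 : (0 < e i)%N by rewrite -(c.1.1) (code_lt c.1).
rewrite (coded_visitE HP g_itv dP)//; set j := e i in ei0 *; set n := (k * j)%N.
have v := c.2 n.+1; have nN : (n < n.+1)%N by [].
pose th := incidence (marks k e) n u; pose cr := crossing_dir (marks k e) n u.
have t0 : 0 < th := incidence_gt0 g_itv dP v nN.
have lE : l n = l 0.
  rewrite /n; elim: (j) => [|j' IH]; first by rewrite muln0.
  by rewrite mulnS addnC arc_lengthP.
have n0 : (0 < n)%N by rewrite muln_gt0 k_gt0.
have [c0 c1] : 0 <= cr /\ cr <= th.
  have nn : (n.-1 < n)%N by rewrite prednK.
  have [M0 h1 h2 h3 h4] := valid_node r_gt0 g_itv dP (c.2 n) nn.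
  have cS := incidenceS r l d0 (marks k e) n.-1 u; rewrite prednK// in cS h1 h2.
  by rewrite /cr /th cS; split=> //; exact: le_refract.
have [M0 h1 h2 _ _] := valid_node r_gt0 g_itv dP v nN.
have q : bounces r l d0 (marks k e) n = (base r l d0 n + 1)%N.
  by rewrite /bounces (_ : marks k e n = true)//; apply/(marksM k_gt0); exists i.
rewrite crossing_dirS q natrD -/th -/cr lE in h1 h2.
set B := base r l d0 n in h1 h2.
pose w := (digit j + 2)%N; pose m := (B %/ w)%N.
have w0 : 0 < w%:R :> R by rewrite ltr0n /w addn2.
have w2 : 2 <= w%:R :> R by rewrite (ler_nat R 2) /w addn2.
have mE : phase P k_gt0 d0 j = m by rewrite /phase gtn_eqF.
exists (cr + (2 * m + 1)%:R * th); split.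
  rewrite /bounce_point mE /=; apply/pi_eqP; exists j%:Z.
  by rewrite /bounce_angle -/cr -/th /n -[(k * j)%N]add0n node_angleM; ring.
have mB1 : (m * w)%:R <= B%:R :> R by rewrite ler_nat leq_trunc_div.
have mB2 : B%:R <= (m * w)%:R + w%:R :> R.
  by rewrite -natrD ler_nat {1}(divn_eq B w) leq_add2l ltnW// ltn_pmod// /w addn2.
rewrite natrM in mB1 mB2.
have th2 : th <= 9 / 8 * d n.
  have [_] := v n nN; rewrite -/th ler_norml => /andP[_]; have /andP[? ?] := g_itv.
  by have := (dP n).1; nra.
set mr := m%:R in mB1 mB2 *; set Br := B%:R in h1 h2 mB1 mB2;
  set wr := w%:R in w0 w2 mB1 mB2 *.
(* The chords at both ends of the arc have directions between [0] and [th]. *)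
have b1 : `|2 * Br * th - l 0| <= 3 * th by rewrite ler_norml; apply/andP; split; lra.
have b2 : `|2 * (mr * wr) * th - l 0| <= 5 * (wr * th).
  have : 2 * (mr * wr) * th <= 2 * Br * th by rewrite ler_pM2r// ler_pM2l.
  have : 2 * Br * th <= 2 * (mr * wr + wr) * th by rewrite ler_pM2r// ler_pM2l.
  have : 2 * th <= wr * th by rewrite ler_pM2r.
  move: b1; rewrite !ler_norml => /andP[? ?]; move=> *; apply/andP; split; lra.
have b3 : `|2 * mr * th - l 0 / wr| <= 5 * th.
  have E : 2 * (mr * wr) * th - l 0 = (2 * mr * th - l 0 / wr) * wr.
    by field; rewrite gt_eqF.
  rewrite E normrM (gtr0_norm w0) in b2.
  by rewrite -(ler_pM2r w0); lra.
rewrite (natrD _ (2 * m)) natrM -/w -/mr -/wr.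
move: b3; rewrite !ler_norml => /andP[? ?]; apply/andP; split; lra.
Qed.

Lemma reciprocal_gap (a b M : nat) : (a < M)%N -> (b < M)%N -> a != b ->
  (M.+1%:R ^+ 2)^-1 <= `|((a + 2)%:R)^-1 - ((b + 2)%:R)^-1| :> R.
Proof.
wlog ab : a b / (a < b)%N.
  move=> W aM bM; rewrite neq_ltn => /orP[ab|ba]; first by apply: W; rewrite // neq_ltn ab.
  by rewrite distrC; apply: W; rewrite // neq_ltn ba.
move=> aM bM _.
have a0 : 0 < (a + 2)%:R :> R by rewrite ltr0n addn2.
have b0 : 0 < (b + 2)%:R :> R by rewrite ltr0n addn2.
have -> : ((a + 2)%:R)^-1 - ((b + 2)%:R)^-1 = ((b + 2)%:R - (a + 2)%:R) / ((a + 2)%:R *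
  (b + 2)%:R) :> R.
  by field; apply/andP; split; rewrite gt_eqF.
have ab1 : 1 <= (b + 2)%:R - (a + 2)%:R :> R by rewrite lerBrDr nat1r ler_nat; lia.
rewrite gtr0_norm; last by rewrite divr_gt0 ?mulr_gt0//; lra.
rewrite ler_pdivlMr ?mulr_gt0// mulrC ler_pdivrMr ?exprn_gt0 ?ltr0n//.
apply: le_trans (_ : M.+1%:R ^+ 2 <= _); last by rewrite ler_peMl// exprn_ge0// ler0n.
by rewrite expr2; apply: ler_pM; rewrite ?ler_nat ?addn2 ?ltnS ?ler0n.
Qed.

Section Block.
Variables (M L0 : nat).
Hypothesis M_gt0 : (0 < M)%N.
Implicit Type w : nat -> nat.

(** The symbol [w m] selects the valuation of one turn in block [m + L0] of [2 ^ M] turns. Unlike in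
    [code_of], the entries are bounded independently of the symbols, which gives compactness; [L0]
    moves them to turns with small angles. *)
Definition block_code w i : nat :=
  if i is m.+1 then (2 ^ M * (m + L0) + 2 ^ w m)%N else 0%N.

Lemma digit_block_code w i : (w i < M)%N -> digit (block_code w i.+1) = w i.
Proof.
move=> wM; have -> : block_code w i.+1 = (2 ^ w i * (2 ^ (M - w i) * (i + L0)).+1)%N.
  by rewrite mulnS mulnA -expnD subnKC ?(ltnW wM)// addnC.
rewrite /digit lognM ?expn_gt0//.
rewrite pfactorK// lognE /= dvdn2 /= oddM oddX.
have -> : (M - w i == 0)%N = false by lia.
by rewrite /= ?addn0.
Qed.

Lemma code_block_code w : (forall i, (w i < M)%N) -> code (block_code w).
Proof.
move=> wM; split=> // -[|i] /=.
  by rewrite addn_gt0 expn_gt0 orbT.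
have h1 : (2 ^ w i < 2 ^ M)%N by rewrite ltn_exp2l.
have h2 : (0 < 2 ^ w i.+1)%N by rewrite expn_gt0.
rewrite addSn mulnS; lia.
Qed.

Lemma block_code_le w i : (forall i, (w i < M)%N) -> (block_code w i.+1 <= 2 ^ M * (i +
  L0).+1)%N.
Proof. by move=> wM; rewrite /= mulnS addnC leq_add2r leq_exp2l// ltnW. Qed.

Lemma block_code_ge w i : (L0 <= block_code w i.+1)%N.
Proof.
apply: leq_trans (leq_addr _ _); apply: leq_trans (leq_addl i _) _.
by rewrite leq_pmull// expn_gt0.
Qed.

Lemma eq_block_marks N w w' : (forall i, (w i < M)%N) -> (forall i, (w' i < M)%N) ->
  (forall i, (i < N)%N -> w i = w' i) ->
  forall n, (n < N)%N -> marks k (block_code w) n = marks k (block_code w') n.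
Proof.
have sub f f' : (forall i, (f i < M)%N) -> (forall i, (i < N)%N -> f i = f' i) ->
    forall n, (n < N)%N -> marks k (block_code f) n -> marks k (block_code f') n.
  move=> fM ff' n nN /asboolP[i E]; apply/asboolP; exists i; rewrite E; congr (k * _)%N.
  have iN : (i <= n)%N.
    rewrite E; apply: leq_trans (code_ge i (code_block_code fM)) _.
    by rewrite leq_pmull.
  by case: i {E} iN => // i iN; rewrite /= ff'// (leq_trans iN)// ltnW.
move=> wM wM' ww' n nN; apply/idP/idP; first exact: sub.
by apply: sub => // i iN; rewrite ww'.
Qed.

Definition block_angles : set R :=
  [set u | exists w, (forall i, (w i < M)%N) /\ coded (block_code w) u].

Let extend N (f : {ffun 'I_N -> 'I_M}) i : nat := oapp (fun j : 'I_N => nat_of_ord (f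
  j)) 0%N (insub i).

Let extend_lt N (f : {ffun 'I_N -> 'I_M}) i : (extend f i < M)%N.
Proof. by rewrite /extend; case: insub => /=. Qed.

Let extendE N w (wM : forall i, (w i < M)%N) i : (i < N)%N ->
  extend [ffun j : 'I_N => Ordinal (wM j)] i = w i.
Proof. by move=> iN; rewrite /extend insubT/= ffunE. Qed.

(** Up to [N] only finitely many words matter. If [u] is valid for some word at every [N], these
    words are consistent because [u] determines the prefixes, and they combine into one sequence. *)
Lemma closed_block_angles : closed block_angles.
Proof.
pose A N : set R := \bigcup_(f in [set: {ffun 'I_N -> 'I_M}])
  [set u | valid N (marks k (block_code (extend f))) u].
suff -> : block_angles = \bigcap_(N in setT) A N.
  apply: closed_bigI => N _; apply: closed_bigcup => [|f _]; first exact: finite_finset.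
  exact: closed_valid.
apply/seteqP; split=> [u [w [wM c]] N _|u uA].
  exists [ffun j : 'I_N => Ordinal (wM j)] => //.
  apply: eq_valid (c.2 N); apply: eq_block_marks => // i iN.
  by rewrite extendE.
have uA' N : exists w, (forall i, (w i < M)%N) /\ valid N (marks k (block_code w)) u.
  by have [f _ v] := uA N I; exists (extend f).
have [W /all_and2[WM Wv]] := choice uA'.
(* Validity up to [B i] determines entry [i + 1] of the code, by [block_code_le], and thus the
   symbol [i]. *)
pose B i := (k * (2 ^ M * (i + L0).+1).+1)%N.
have agree i N : (B i <= N)%N -> W N i = W (B i) i.
  move=> BN; have vN := valid_le BN (Wv N).
  rewrite -(digit_block_code (WM N i)) -(digit_block_code (WM (B i) i)).
  congr digit; apply: (@code_prefix k k_gt0 (2 ^ M * (i + L0).+1).+1 _ _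
    (code_block_code (WM (B i))) (code_block_code (WM N))).
    by move=> n nL; apply: (valid_inj r_gt0 g_itv dP (Wv (B i)) vN).
  by rewrite ltnS block_code_le.
exists (fun i => W (B i) i); split=> [i|]; first exact: WM.
split=> [|N]; first by apply: code_block_code => i; exact: WM.
have BN : (N <= B N)%N.
  apply: leq_trans (_ : 2 ^ M * (N + L0).+1 <= _)%N; last first.
    by apply: leq_trans (leq_pmull _ k_gt0); rewrite leqnSn.
  apply: leq_trans (leq_pmull _ _); last by rewrite expn_gt0.
  by rewrite leqW// leq_addr.
apply: eq_valid (valid_le BN (Wv (B N))); apply: eq_block_marks; [exact: WM|by move=> i;
  exact: WM|].
move=> i iN; apply: agree; rewrite leq_pmul2l// ltnS leq_pmul2l ?expn_gt0//.
by rewrite ltnS leq_add2r ltnW.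
Qed.

Lemma compact_block_angles : compact (start @` block_angles).
Proof.
have cb : compact block_angles.
  rewrite (_ : block_angles = initial_angles d0 `&` block_angles).
    by apply: compact_closedI; [exact: segment_compact|exact: closed_block_angles].
  apply/seteqP; split=> u; last by case.
  by move=> h; split=> //; case: h => w [_ c];
    exact: (valid_initial g_itv d0_gt0 (ltn0Sn 0) (c.2 1)).
apply: continuous_compact => //; apply: continuous_subspaceT => u.
apply: (@cvg_pair _ _ _ (nbhs u) (nbhs (start u).1) (nbhs u)); last exact: cvg_id.
exact: cvg_cst.
Qed.

Lemma block_observed : start @` block_angles `<=` observed.
Proof. by move=> _ [u [w [_ c]] <-]; rewrite -(visit0 c); exact: observed_visit. Qed.

Hypothesis fine_scale : forall j, (L0 <= j)%N -> 12 * d (k * j) <= l 0 / (M.+1)%:R ^+ 2 / 4.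

(** Words that differ at [i] give visits [i + 1] at fractions of the first arc whose distance is at
    least [s]; each position is known up to [s / 4], so the scale [s / 4] separates them. *)
Lemma block_entropy : ((ln (M%:R : R) / 2)%:E <=
  bowen_entropy_on (@phase_dist R) (return_map (billiard P) observed) (start @`
    block_angles))%E.
Proof.
pose s : R := l 0 / (M.+1)%:R ^+ 2.
have l0 := l_gt0 0.
have s0 : 0 < s by rewrite divr_gt0// exprn_gt0// ltr0n.
have s4 : s <= l 0 / 4.
  rewrite ler_pM2l// lef_pV2 ?posrE ?exprn_gt0 ?ltr0n//.
  by rewrite -natrX (ler_nat R 4) (leq_exp2r 2 _ (ltn0Sn 1)).
have l2pi : l 0 <= 2 * pi.
  have : node_angle P k_gt0 1 <= node_angle P k_gt0 (0 + k) by rewrite node_angle_le_mono.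
  by rewrite node_angleP /arc_length; lra.
apply: (@entropy_ge _ _ _ _ _ (s / 4)) => //; first by rewrite divr_gt0.
move=> n.
have ex (f : {ffun 'I_n -> 'I_M}) : exists u, coded (block_code (extend f)) u.
  exact: exists_coded (code_block_code (extend_lt f)).
have [U cU] := choice ex; exists (fun f => start (U f)).
have ext (h : {ffun 'I_n -> 'I_M}) (i : 'I_n) : extend h i = h i by rewrite /extend valK.
have sep f f' : f <> f' -> exists2 i, (i < n.+1)%N &
    s / 4 < phase_dist (iter i (return_map (billiard P) observed) (start (U f)))
                       (iter i (return_map (billiard P) observed) (start (U f'))).
  move=> ff'; have [i fi] : exists i : 'I_n, f i != f' i.
    apply/existsP; rewrite -negb_forall; apply/negP => /forallP h; apply: ff'.
    by apply/ffunP => i; apply/eqP.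
  exists i.+1; first by rewrite ltnS.
  rewrite -(visit0 (cU f)) -(visit0 (cU f')) !(iter_return_visit HP g_itv dP)// !add0n.
  have [x [xE xP]] := visit_angle (cU f) (ltn0Sn i).
  have [y [yE yP]] := visit_angle (cU f') (ltn0Sn i).
  rewrite digit_block_code ?extend_lt// ext in xP.
  rewrite digit_block_code ?extend_lt// ext in yP.
  have fx := le_trans xP (fine_scale (block_code_ge _ _)).
  have fy := le_trans yP (fine_scale (block_code_ge _ _)).
  rewrite -/s in fx fy.
  have far : s <= `|l 0 / (f i + 2)%:R - l 0 / (f' i + 2)%:R|.
    rewrite -mulrBr normrM (gtr0_norm l0) ler_pM2l//.
    by apply: reciprocal_gap => //; rewrite ltn_ord.
  (* Both positions lie near the first half of the arc, and [l 0 <= 2 * pi], so the distance the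
     other way round is no obstacle. *)
  have near (a : 'I_M) : 0 < l 0 / (a + 2)%:R <= l 0 / 2.
    rewrite divr_gt0 ?ltr0n ?addn2//= ler_pM2l// lef_pV2 ?posrE ?ltr0n//.
    by rewrite (ler_nat R 2).
  have /andP[nx1 nx2] := near (f i); have /andP[ny1 ny2] := near (f' i).
  apply: lt_le_trans (_ : circle_dist (visit (block_code (extend f)) i.+1 (U f)).1
    (visit (block_code (extend f')) i.+1 (U f')).1 <= _); last first.
    rewrite /phase_dist; set D := circle_dist _ _.
    apply: le_trans (ler_norm D) _; rewrite -sqrtr_sqr.
    by rewrite ler_wsqrtr// lerDl sqr_ge0.
  rewrite xE yE; apply: lt_le_trans (_ : s / 2 <= _); first by lra.
  set a := l 0 / _ in far fx nx1 nx2; set b := l 0 / _ in far fy ny1 ny2.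
  have xy : node_angle P k_gt0 0 + x - (node_angle P k_gt0 0 + y) = x - y by ring.
  move: fx fy; rewrite !ler_norml => /andP[? ?] /andP[? ?].
  have d1 : `|(x - y) - (a - b)| <= s / 2 by rewrite ler_norml; apply/andP; split; lra.
  have ab : `|a - b| <= l 0 / 2 by rewrite ler_norml; apply/andP; split; lra.
  have := ler_normD (a - b) ((x - y) - (a - b)); rewrite subrKC.
  have := ler_normB (x - y) ((x - y) - (a - b)); rewrite subKr.
  by move=> ? ?; apply: circle_dist_ge; rewrite xy; lra.
split=> [f f' /(congr1 snd)/= E|f|f f' ff'].
- have := cU f'; rewrite -E => /(coded_inj g_itv dP (cU f)) eff'.
  apply/ffunP => i; apply/val_inj; rewrite /= -!ext.
  by rewrite -(digit_block_code (extend_lt f i)) eff' digit_block_code// extend_lt.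
- by exists (U f) => //; exists (extend f).
- exact: sep.
Qed.

End Block.
End EntropyOfReturnMap.

Lemma eq_pinfty_of_ln (R : realType) (x : \bar R) :
  (forall M : nat, (0 < M)%N -> ((ln (M%:R : R) / 2)%:E <= x)%E) -> x = +oo%E.
Proof.
move=> H; apply: eq_infty => A.
have lt := archi_boundP (expR_ge0 (2 * A)).
have M0 : (0 < Num.Def.archi_bound (expR (2 * A)))%N.
  by rewrite -(ltr0n R); apply: lt_trans lt; exact: expR_gt0.
apply: le_trans (H _ M0); rewrite lee_fin.
have : ln (expR (2 * A)) <= ln (Num.Def.archi_bound (expR (2 * A)))%:R :> R.
  by rewrite ler_ln ?posrE ?expR_gt0 ?ltr0n// ltW.
by rewrite expRK; lra.
Qed.

Theorem theorem1 (R : realType) (k : nat) (P : arc_chain R k)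
    (HP : circular_gon P) :
  exists J : set (circle R * R),
    let F := return_map (billiard P) J in
    [/\ J `<=` @phase_space R,
        clusters_at_boundary J,
        recurrent (billiard P) J,
        exists (Q : discreteTopologicalType) (S : set {ptws int -> Q}),
          [/\ infinite_set [set: Q], subshift S, shift_transitive S,
              semiconjugate J F S (@left_shift Q) &
              forall N, (0 < N)%N -> has_full_shift_factor S N] &
        bowen_entropy (@phase_dist R) F J = +oo%E].
Proof.
have k_gt0 : (0 < k)%N by case: HP => -[/ltnW].
have [g [d0 [g_itv d0_gt0 gapP turnP dP]]] := parameters k_gt0
  (arc_radius_gt0 P k_gt0) (arc_length_gt0 P k_gt0) (arc_radiusP P k_gt0)
  (arc_lengthP P k_gt0) (arc_radius_neq k_gt0 HP).
exists (observed P k_gt0 g d0); split.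
- exact: observed_phase_space.
- exact: observed_clusters.
- exact: observed_recurrent.
- exists (discrete_topology nat), [set: {ptws int -> discrete_topology nat}].
  split; [exact: infinite_nat|exact: full_subshift|exact: full_transitive|
    |exact: full_shift_factor].
  exact: semiconjugate_coding.
apply: eq_pinfty_of_ln => M M0.
have l0 := arc_length_gt0 P k_gt0 0.
(* From turn [L] on the error in [visit_angle] is at most a quarter of the least distance between
   the positions of two symbols. *)
have c0 : 0 < arc_length P k_gt0 0 / M.+1%:R ^+ 2 / 4 / 12.
  by rewrite !divr_gt0// exprn_gt0// ltr0n.
have [L HL] := prescribed_small k_gt0 HP d0_gt0 c0.
have fine_scale j : (L <= j)%N -> 12 * prescribed (arc_radius P k_gt0) d0 (k * j) <=
    arc_length P k_gt0 0 / M.+1%:R ^+ 2 / 4 by move/HL/ltW; rewrite ler_pdivlMr// mulrC.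
apply: le_trans (block_entropy HP g_itv d0_gt0 gapP dP M0 fine_scale) _.
apply: ereal_sup_ubound.
exists (start P k_gt0 @` block_angles P k_gt0 g d0 M L) => //.
by split; [exact: compact_block_angles|exact: block_observed].
Qed.
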